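(* Let $\mu$ and $\tilde\mu$ be two probability measures supported on a compact interval $I\subset\mathbb{R}$, with $\mu$ satisfying the standing assumptions below. Let $\nu^{(k)}$ be a solution to $\min_{\lambda\in\mathcal{P}_k(\mathbb{R})}W_1(\mu,\lambda)$ with support points $y_1\le\dots\le y_k$, let $\tilde y_1\le\dots\le\tilde y_k$ be the support points of a solution to $\min_{\lambda\in\mathcal{P}_k(\mathbb{R})}W_1(\tilde\mu,\lambda)$, and set $\vec v_\mu=(F_\mu(y_j))_{j\in[k]}$ and $\vec v_{\tilde\mu}=(F_{\tilde\mu}(\tilde y_j))_{j\in[k]}$. Let $\vec X_n$ be $n$ i.i.d. random variables with law $\mu$. Then \[ \lim_{n\to\infty}\Bigg|\frac{\mathbb{E}[SC_{\vec v_{\tilde\mu}}(\vec X_n)]}{\mathbb{E}[SC_{opt}(\vec X_n)]}-1\Bigg|\le\frac{W_\infty(\mu,\tilde\mu)+2W_1(\mu,\tilde\mu)}{W_1(\mu,\nu^{(k)})}\le 3\,\frac{W_\infty(\mu,\tilde\mu)}{W_1(\mu,\nu^{(k)})}. \] Moreover, for every $n>k$ there exists a constant $C>0$ such that \[ \big|B^{(n)}_{ar}(\mathcal{PM}_{\vec v_\mu})-B^{(n)}_{ar}(\mathcal{PM}_{\vec v_{\tilde\mu}})\big|\le 3\,\frac{W_\infty(\mu,\tilde\mu)}{W_1(\mu,\nu^{(k)})}+\frac{C}{\sqrt n}. \]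
   Context: For $\vec x\in\mathbb{R}^n$, $\vec y\in\mathbb{R}^k$: $SC(\vec x,\vec y)=\frac1n\sum_i\min_j|x_i-y_j|$, $SC_{opt}(\vec x)=\min_{\vec y}SC(\vec x,\vec y)$. A percentile vector is $\vec v$ with $0\le v_1\le\dots\le v_k\le1$; $\mathcal{PM}_{\vec v}$ sorts the reports $x_{(1)}\le\dots\le x_{(n)}$ and places facility $j$ at $x_{(\lfloor(n-1)v_j\rfloor+1)}$; $SC_{\vec v}(\vec x)$ is the Social Cost of its output. $B^{(n)}_{ar}(f)=\mathbb{E}[SC_f(\vec X_n)]/\mathbb{E}[SC_{opt}(\vec X_n)]$, expectations with respect to the agents' true law $\mu$. $\mathcal{P}_k(\mathbb{R})$: probability measures $\sum_{j=1}^k\nu_j\delta_{x_j}$ ($\nu_j\ge0$, $\sum\nu_j=1$). $W_1(\alpha,\beta)=\min_{\pi\in\Pi(\alpha,\beta)}\int|x-y|d\pi$ and $W_\infty(\alpha,\beta)=\min_{\pi\in\Pi(\alpha,\beta)}\max_{(x,y)\in\mathrm{spt}(\pi)}|x-y|$, $\Pi(\alpha,\beta)$ being the couplings. $F_\eta$ denotes the c.d.f. of $\eta$. Standing assumptions on $\mu$: absolutely continuous with density $\rho_\mu$; support an interval on whose interior $\rho_\mu>0$; $\rho_\mu$ differentiable on the support. *)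

(* Defs.v *)
From HB Require Import structures.
From mathcomp Require Import all_boot all_order all_algebra.
From mathcomp Require Import all_classical all_reals all_analysis.
Set Implicit Arguments. Unset Strict Implicit. Unset Printing Implicit Defensive.
Import Order.TTheory GRing.Theory Num.Theory.
Import numFieldNormedType.Exports.
Local Open Scope classical_set_scope.
Local Open Scope ring_scope.

Section Defs.
Variable R : realType.

(* min_j |x - y_j| for a nonempty list y *)
Definition dist_to (x : R) (y : seq R) : R :=
  \big[Num.min/`|x - head 0 y|]_(yj <- y) `|x - yj|.

Definition SC (x y : seq R) : R :=
  (size x)%:R^-1 * \sum_(xi <- x) dist_to xi y.

Definition SCopt (k : nat) (x : seq R) : R :=
  inf [set SC x y | y in [set y : seq R | size y = k]].

(* percentile mechanism: facility j at x_(floor((n-1) v_j) + 1) (1-indexed)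
   i.e. at index floor((n-1) v_j) (0-indexed) of the sorted reports *)
Definition PM (v : seq R) (x : seq R) : seq R :=
  [seq nth 0 (sort <=%R x) `|Num.floor (((size x)%:R - 1) * vj)|%N | vj <- v].

Definition SCv (v : seq R) (x : seq R) : R := SC x (PM v x).

(* E[f(X_1,...,X_n)] for X_1..X_n i.i.d. with law mu, as an iterated integral
   (equal to the integral w.r.t. the product measure by Tonelli, f >= 0). *)
Fixpoint iidE (mu : probability R R) (n : nat) (f : seq R -> \bar R) : \bar R :=
  match n with
  | 0 => f [::]
  | n'.+1 => (\int[mu]_x iidE mu n' (fun s => f (x :: s)))%E
  end.

Definition Eiid (mu : probability R R) (n : nat) (g : seq R -> R) : \bar R :=
  iidE mu n (fun s => (g s)%:E).

Definition Bar (mu : probability R R) (k n : nat) (v : seq R) : R :=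
  fine (Eiid mu n (SCv v)) / fine (Eiid mu n (SCopt k)).

Definition cdfmu (mu : probability R R) (y : R) : R := fine (mu [set` `]-oo, y]]).

Definition coupling (a b : probability R R) (pi : probability (R * R)%type R) :=
  (forall A, measurable A -> pi (A `*` setT) = a A) /\
  (forall B, measurable B -> pi (setT `*` B) = b B).

Definition W1 (a b : probability R R) : \bar R :=
  ereal_inf [set (\int[pi]_z (`|z.1 - z.2|)%:E)%E
            | pi in [set pi | coupling a b pi]].

(* max over spt(pi) of |x-y|, written as the pi-essential sup of the continuous
   function |x - y|, minimized over couplings *)
Definition Winf (a b : probability R R) : \bar R :=
  ereal_inf [set c%:E | c in [set c : R | exists pi, coupling a b pi /\
                                   pi [set z | c < `|z.1 - z.2|] = 0%E]].

Definition is_discrete_k (k : nat) (lam : probability R R)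
    (x : 'I_k -> R) (w : 'I_k -> R) :=
  (forall j, 0 <= w j) /\ \sum_j w j = 1 /\
  (forall A, measurable A -> lam A = (\sum_j (w j)%:E * \d_(x j) A)%E).

Definition in_Pk (k : nat) (lam : probability R R) :=
  exists (x w : 'I_k -> R), is_discrete_k lam x w.

Definition W1_opt (k : nat) (mu nu : probability R R) :=
  in_Pk k nu /\ forall lam, in_Pk k lam -> (W1 mu nu <= W1 mu lam)%E.

Definition sorted_support (k : nat) (nu : probability R R) (y : 'I_k -> R) :=
  (forall i j : 'I_k, (i <= j)%N -> y i <= y j) /\
  exists w, (forall j, 0 < w j) /\ is_discrete_k nu y w.

Definition spt (mu : probability R R) : set R :=
  [set x | forall U, open U -> U x -> (0 < mu U)%E].

Definition standing (mu : probability R R) :=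
  exists rho : R -> R,
    measurable_fun setT rho /\ (forall x, 0 <= rho x) /\
    (forall A, measurable A ->
       mu A = (\int[lebesgue_measure]_(x in A) (rho x)%:E)%E) /\
    exists a b : R, a < b /\ spt mu = [set` `[a, b]] /\
      (forall x, a < x < b -> 0 < rho x) /\
      (forall x, x \in `[a, b] -> exists l : R,
         ((fun y => (rho y - rho x) / (y - x)) @
            within [set y | y \in `[a, b] /\ y != x] (nbhs x)) --> l).

End Defs.

(* Main.v *)
Require Import Defs.
From HB Require Import structures.
From mathcomp Require Import all_boot all_order all_algebra.
From mathcomp Require Import all_classical all_reals all_analysis.
From mathcomp Require Import measurable_realfun.
From mathcomp Require Import ring lra.
Import Order.TTheory GRing.Theory Num.Theory.
Import numFieldNormedType.Exports.
Local Open Scope classical_set_scope.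
Local Open Scope ring_scope.
Set Implicit Arguments. Unset Strict Implicit. Unset Printing Implicit Defensive.

(** The mu-mean distance [qcost mu ys] to the points [ys] has minimum
    W_1(mu, nu), attained at the support of the optimal quantizer [nu], and is
    1-Lipschitz for W_1 in the law and for the sup norm in [ys].  The percentile
    mechanism with vector F_mut(yt_j) places its facilities near the mu-quantiles
    q_j of these levels; a coupling with |x - x'| <= w sandwiches F_mut between
    shifts of F_mu by w, so |q_j - yt_j| <= w once yt_j is clipped to the
    w-neighbourhood of the support, whence the mean distance to the q_j exceeds
    the minimum by at most W_inf + 2 W_1.

    All sampling errors are controlled by second moments of the deviation of the
    empirical c.d.f. from F_mu: the social cost by Abel summation over a grid, the
    order statistics by Chebyshev's inequality at distance i / sqrt n from q_j,
    where the density is bounded below.  At the endpoints of the support the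
    density may vanish and order statistics are only shown to be consistent, which
    is enough for the limit; the rate is only needed from above, and there an
    extreme order statistic serves the sample at least as well as the endpoint.
    Every ratio is at least 1, so upper bounds suffice for the difference of two
    ratios; the finitely many small n are absorbed in the constant. *)

(** * Real sequences and rates *)

Section RealSequences.
Context (R : realType).

Lemma normr_le_half_sqr (x h : R) : 0 < h -> `|x| <= h / 2 + (2 * h)^-1 * x ^+ 2.
Proof.
move=> h0; rewrite -[x ^+ 2]real_normK ?num_real//; move: `|x| => z; rewrite -subr_ge0.
have -> : h / 2 + (2 * h)^-1 * z ^+ 2 - z = (2 * h)^-1 * (z - h) ^+ 2.
  by field; rewrite gt_eqF.
by rewrite mulr_ge0 ?sqr_ge0// invr_ge0 mulr_ge0// ltW.
Qed.

Lemma le_layer_sum (h z : R) M : 0 <= h -> z <= h * M.+1%:R ->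
  z <= h + \sum_(i < M) h * (i.+1%:R * h < z)%R%:R.
Proof.
move=> h0; elim: M => [|M IH] zM; first by rewrite big_ord0 addr0 -[h]mulr1.
rewrite big_ord_recr /=; have [le_z|lt_z] := leP z (M.+1%:R * h).
  by rewrite mulr0 addr0; apply: IH; rewrite mulrC.
have -> : \sum_(i < M) h * (i.+1%:R * h < z)%R%:R = \sum_(i < M) h.
  apply: eq_bigr => i _; rewrite (le_lt_trans _ lt_z) ?mulr1//.
  by rewrite ler_wpM2r// ler_nat ltnS ltnW.
rewrite big_const_ord iter_addr_0 -[h *+ M]mulr_natl.
by rewrite mulr1; move: zM; rewrite -[M.+2%:R]natr1 -[M.+1%:R]natr1; lra.
Qed.

Lemma sum_inv_sqr_le2 M : \sum_(i < M) (i.+1%:R ^+ 2)^-1 <= 2 :> R.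
Proof.
case: M => [|M]; first by rewrite big_ord0.
suff : \sum_(i < M.+1) (i.+1%:R ^+ 2)^-1 <= 2 - M.+1%:R^-1 :> R.
  by move=> /le_trans; apply; rewrite gerBl invr_ge0.
elim: M => [|M IH].
  by rewrite big_ord_recr big_ord0 /= expr1n invr1 add0r; lra.
rewrite big_ord_recr /=; apply: le_trans (lerD IH (lexx _)) _.
have m0 : 0 < M.+1%:R :> R by rewrite ltr0n.
rewrite -[M.+2%:R]natr1; move: (M.+1%:R) m0 => m m0.
have m1 : 0 < m + 1 by rewrite addr_gt0.
rewrite -subr_ge0.
have -> : 2 - (m + 1)^-1 - (2 - m^-1 + ((m + 1) ^+ 2)^-1) =
   (m * (m + 1) ^+ 2)^-1 by field; rewrite !gt_eqF.
by rewrite invr_ge0 mulr_ge0 ?sqr_ge0// ltW.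
Qed.

Lemma fine_between (r t : R) (x : \bar R) : (r%:E <= x <= t%:E)%E ->
  x \is a fin_num /\ r <= fine x <= t.
Proof. by case: x => [x| |] /=; rewrite ?lee_fin// leye_eq andbF. Qed.

Lemma filter_in_seq T (F : set_system T) {FF : Filter F} (I : eqType) (r : seq I)
    (P : I -> T -> Prop) :
  {in r, forall i, \forall x \near F, P i x} ->
  \forall x \near F, {in r, forall i, P i x}.
Proof.
elim: r => [|i r IH] rP; first exact: nearW.
have Pi := rP i (mem_head i r).
have Pr : \forall x \near F, {in r, forall j, P j x}.
  by apply: IH => j jr; apply: rP; rewrite inE jr orbT.
by apply: filterS2 Pi Pr => x Pix Prx j; rewrite inE => /predU1P[->|/Prx].
Qed.

Lemma near_invn_le (e : R) : 0 < e -> \forall n \near \oo, n%:R^-1 <= e.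
Proof.
move=> e0; near=> n; rewrite invf_ple ?posrE//; first by near: n; exact: nbhs_infty_ger.
by rewrite ltr0n; near: n; exact: nbhs_infty_gt.
Unshelve. all: by end_near. Qed.

Lemma cvg_div_sqrt0 (C : R) : C / Num.sqrt n%:R @[n --> \oo] --> 0.
Proof.
apply/cvgrPdist_le => e e0; have C1 : 0 < `|C| + 1 by rewrite ltr_wpDl.
have eC1 : 0 < e / (`|C| + 1) by rewrite divr_gt0.
near=> n; rewrite sub0r normrN normrM [X in _ * X]ger0_norm ?invr_ge0 ?sqrtr_ge0//.
have n_gt0 : 0 < n%:R :> R by rewrite ltr0n; near: n; exact: nbhs_infty_gt.
have : (Num.sqrt n%:R)^-1 <= e / (`|C| + 1).
  rewrite -(@ler_pXn2r _ 2)// ?nnegrE ?invr_ge0 ?sqrtr_ge0 ?(ltW eC1)//.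
  rewrite exprVn sqr_sqrtr ?(ltW n_gt0)//.
  by near: n; apply: near_invn_le; rewrite exprn_gt0.
rewrite ler_pdivlMr//.
have : 0 <= (Num.sqrt n%:R)^-1 :> R by rewrite invr_ge0 sqrtr_ge0.
lra.
Unshelve. all: by end_near. Qed.

Lemma ratio_le_rate (D W C0 C1 h x o : R) : 0 <= D -> 0 < W -> 0 <= C1 -> 0 <= C0 ->
  0 <= h -> W / 2 <= o -> W - C0 * h <= o -> x <= D + C1 * h ->
  x / o <= D / W + 2 * (D * C0 / W + C1) / W * h.
Proof.
move=> D0 W0 C10 C00 h0 o_half o_ge x_le.
have o0 : 0 < o by apply: lt_le_trans o_half; rewrite divr_gt0.
have C_ge0 : 0 <= 2 * (D * C0 / W + C1) / W.
  by rewrite divr_ge0 ?(ltW W0)// mulr_ge0// addr_ge0// divr_ge0 ?mulr_ge0 ?(ltW W0).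
have DW_o : D - D * C0 / W * h <= D / W * o.
  apply: le_trans (ler_wpM2l (divr_ge0 D0 (ltW W0)) o_ge).
  by rewrite le_eqVlt; apply/orP; left; apply/eqP; field; rewrite gt_eqF.
have C_o : (D * C0 / W + C1) * h <= 2 * (D * C0 / W + C1) / W * h * o.
  apply: le_trans (ler_wpM2l (mulr_ge0 C_ge0 h0) o_half).
  by rewrite le_eqVlt; apply/orP; left; apply/eqP; field; rewrite gt_eqF.
by rewrite ler_pdivrMr// mulrDl; lra.
Qed.

Lemma near_rate_all (f : R^nat) (A C : R) : 0 <= A -> 0 <= C ->
  (\forall n \near \oo, f n <= A + C / Num.sqrt n%:R) ->
  exists C', 0 < C' /\ forall n, (0 < n)%N -> f n <= A + C' / Num.sqrt n%:R.
Proof.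
move=> A0 C0 [N _ fN]; pose small := \sum_(i < N) `|f i| * Num.sqrt i%:R.
have small0 : 0 <= small by apply: sumr_ge0 => i _; rewrite mulr_ge0// sqrtr_ge0.
exists (C + small + 1); split; first by rewrite ltr_wpDl// addr_ge0.
move=> n n0; have s0 : 0 < Num.sqrt n%:R :> R by rewrite sqrtr_gt0 ltr0n.
have [Nn|nN] := leqP N n.
  apply: le_trans (fN n Nn) _; rewrite lerD2l ler_pM2r ?invr_gt0//; lra.
have f_small : `|f n| <= small / Num.sqrt n%:R.
  rewrite ler_pdivlMr// /small (bigD1 (Ordinal nN))//= lerDl.
  by apply: sumr_ge0 => i _; rewrite mulr_ge0// sqrtr_ge0.
apply: le_trans (ler_norm _) _; apply: le_trans f_small _.
by rewrite -[leLHS]add0r lerD// ler_pM2r ?invr_gt0//; lra.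
Qed.

End RealSequences.

(** * Integration without measurability, pushforwards and couplings *)

Section IntegralMonotone.
Context (d : measure_display) (T : measurableType d) (R : realType).
Variable P : {measure set T -> \bar R}.
Implicit Types f g : T -> \bar R.
Import HBNNSimple.
Local Open Scope ereal_scope.

(* The library's integral is a supremum over simple functions below the
   integrand, so monotonicity needs no measurability of [f] or [g]. *)
Let ge0_le_integral_null (A : set T) f g : measurable A -> P (~` A) = 0 ->
  (forall x, 0 <= f x) -> (forall x, 0 <= g x) ->
  (forall x, A x -> f x <= g x) -> \int[P]_x f x <= \int[P]_x g x.
Proof.
move=> mA PA f0 g0 fg; rewrite !ge0_integralTE//.
apply: ge_ereal_sup => _ [h /= hf <-].
have -> : sintegral P h = \int[P]_x (h x)%:E.
  by rewrite integral_nnsfun// patch_setT.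
have mh : measurable_fun [set: T] (EFin \o h) by apply/measurable_EFinP.
rewrite (@ge0_negligible_integral _ _ _ P setT (~` A))//; last 2 first.
- exact: measurableC.
- by move=> x _; rewrite lee_fin.
rewrite setTD setCK integral_nnsfun//.
apply: ereal_sup_ubound; exists (proj_nnsfun h mA) => //=.
  move=> x; rewrite mindicE; case: (boolP (x \in A)) => xA /=.
    by rewrite mulr1 (le_trans (hf x))// fg// -[A x]inE.
  by rewrite mulr0.
by rewrite -mrestrict.
Qed.

Lemma le_integral_null (A : set T) f g : measurable A -> P (~` A) = 0 ->
  (forall x, A x -> f x <= g x) -> \int[P]_x f x <= \int[P]_x g x.
Proof.
move=> mA PA fg; rewrite integralE [leRHS]integralE; apply: leeB.
  apply: (ge0_le_integral_null mA PA) => // x Ax.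
  by rewrite !funeposE ge_max le_max fg//= le_max lexx orbT.
apply: (ge0_le_integral_null mA PA) => // x Ax.
by rewrite !funenegE ge_max le_max leeN2 fg//= le_max lexx orbT.
Qed.

End IntegralMonotone.

Section ProbabilityIntegral.
Context (d : measure_display) (T : measurableType d) (R : realType).
Variable P : probability T R.

Lemma integral_cst_probability (r : R) : (\int[P]_x r%:E = r%:E)%E.
Proof. by rewrite integral_cst//= probability_setT mule1. Qed.

Lemma Rintegral_cst_probability (r : R) : \int[P]_x r = r.
Proof. by rewrite /Rintegral integral_cst_probability. Qed.

Lemma bounded_integrable_null (A : set T) (f : T -> R) (M : R) :
  measurable A -> P (~` A) = 0%E -> measurable_fun setT f ->
  (forall x, A x -> `|f x| <= M) -> P.-integrable setT (EFin \o f).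
Proof.
move=> mA PA mf fM; apply/integrableP; split; first exact/measurable_EFinP.
apply: (@le_lt_trans _ _ (\int[P]_x M%:E)%E); last first.
  by rewrite integral_cst_probability ltry.
by apply: (le_integral_null mA PA) => x Ax; rewrite lee_fin fM.
Qed.

Lemma normr_Rintegral_le_null (A : set T) (f : T -> R) (M : R) :
  measurable A -> P (~` A) = 0%E -> measurable_fun setT f ->
  (forall x, A x -> `|f x| <= M) -> `|\int[P]_x f x| <= M.
Proof.
move=> mA PA mf fM; have f_int := bounded_integrable_null mA PA mf fM.
apply: (le_trans (le_normr_Rintegral measurableT f_int)).
rewrite -lee_fin /Rintegral fineK.
  rewrite -(integral_cst_probability M).
  by apply: (le_integral_null mA PA) => x Ax; rewrite lee_fin fM.
by apply: integrable_fin_num => //; exact: integrable_norm.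
Qed.

End ProbabilityIntegral.

Section Pushforward.
Context d d' (T : measurableType d) (T' : measurableType d') (R : realType).
Local Open Scope ereal_scope.

Lemma measurable_preimageT (f : T -> T') (A : set T') : measurable_fun setT f ->
  measurable A -> measurable (f @^-1` A).
Proof. by move=> mf mA; rewrite -[_ @^-1` _]setTI; exact: mf. Qed.

Definition pushforward_of (P : probability T R) (f : T -> T')
    (Q : probability T' R) :=
  forall A, measurable A -> Q A = P (f @^-1` A).

Lemma pushforward_exists (P : probability T R) (f : T -> T') :
  measurable_fun setT f -> exists Q, pushforward_of P f Q.
Proof.
move=> mf; pose X : {mfun T >-> T'} := mfun_Sub (mem_set mf : f \in mfun).
by exists (distribution P X : probability T' R).
Qed.

Lemma ge0_integral_pushforward_of (P : probability T R) (f : T -> T')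
    (Q : probability T' R) (g : T' -> R) : measurable_fun setT f ->
  pushforward_of P f Q -> measurable_fun setT g -> (forall y, 0 <= g y)%R ->
  \int[Q]_y (g y)%:E = \int[P]_x (g (f x))%:E.
Proof.
move=> mf PfQ mg g0.
rewrite (@eq_measure_integral _ _ _ setT (pushforward P f)) => [|A mA _].
  rewrite ge0_integral_pushforward//; first exact/measurable_EFinP.
  by move=> y _; rewrite lee_fin.
exact: PfQ.
Qed.

End Pushforward.

Section Coupling.
Context (R : realType).
Implicit Types (a b : probability R R) (pi : probability (R * R)%type R).

Lemma coupling_fst a b pi : coupling a b pi -> pushforward_of pi fst a.
Proof.
move=> [pia _] A mA; rewrite -pia//.
by congr (pi _); apply/seteqP; split => z //=; case.
Qed.

Lemma coupling_snd a b pi : coupling a b pi -> pushforward_of pi snd b.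
Proof.
move=> [_ pib] A mA; rewrite -pib//.
by congr (pi _); apply/seteqP; split => z //=; case.
Qed.

Lemma measurable_distance d (T : measurableType d) (f g : T -> R) :
  measurable_fun setT f -> measurable_fun setT g ->
  measurable_fun setT (fun x => `|f x - g x|).
Proof. by move=> mf mg; apply: measurableT_comp => //; exact: measurable_funB. Qed.

Lemma measurable_far_pairs (w : R) : measurable [set z : R * R | w < `|z.1 - z.2|].
Proof.
have := measurable_preimageT (measurable_distance measurable_fst measurable_snd)
  (measurable_itv `]w, +oo[).
by congr measurable; apply/seteqP; split => z /=; rewrite in_itv/= andbT.
Qed.

Lemma joint_law_coupling d (T : measurableType d) (P : probability T R)
    (f g : T -> R) a b : measurable_fun setT f -> measurable_fun setT g ->
  pushforward_of P f a -> pushforward_of P g b ->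
  exists2 pi, coupling a b pi & pushforward_of P (fun x => (f x, g x)) pi.
Proof.
move=> mf mg Pfa Pgb.
have [pi Ppi] := pushforward_exists P (measurable_fun_pair mf mg).
exists pi => //; split => A mA; rewrite Ppi ?Pfa ?Pgb//; try exact: measurableX.
- by congr (P _); apply/seteqP; split => x //= -[].
- by congr (P _); apply/seteqP; split => x //= -[].
Qed.

Lemma W1_le_joint d (T : measurableType d) (P : probability T R)
    (f g : T -> R) a b : measurable_fun setT f -> measurable_fun setT g ->
  pushforward_of P f a -> pushforward_of P g b ->
  (W1 a b <= \int[P]_x (`|f x - g x|)%:E)%E.
Proof.
move=> mf mg Pfa Pgb; have [pi cpi Ppi] := joint_law_coupling mf mg Pfa Pgb.
rewrite -(ge0_integral_pushforward_of (measurable_fun_pair mf mg) Ppi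
  (measurable_distance measurable_fst measurable_snd))//.
by apply: ereal_inf_lbound; exists pi.
Qed.

Lemma W1_ge0 a b : (0 <= W1 a b)%E.
Proof. by apply: le_ereal_inf_tmp => _ [pi _ <-]; exact: integral_ge0. Qed.

Lemma W1C a b : W1 a b = W1 b a.
Proof.
suff W1_le a' b' : (W1 b' a' <= W1 a' b')%E by apply/eqP; rewrite eq_le !W1_le.
apply: le_ereal_inf_tmp => _ [pi cpi <-].
under eq_integral do rewrite distrC.
apply: W1_le_joint => //; [exact: coupling_snd cpi|exact: coupling_fst cpi].
Qed.

Definition coupled_within (w : R) a b :=
  exists pi, coupling a b pi /\ pi [set z | w < `|z.1 - z.2|] = 0%E.

Lemma coupled_within_ge0 w a b : coupled_within w a b -> 0 <= w.
Proof.
move=> [pi [_ piw]]; rewrite leNgt; apply/negP => w0.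
move: piw; rewrite (_ : [set _ | _] = setT) ?probability_setT.
  by move=> /eqP; rewrite onee_eq0.
by apply/seteqP; split => z //= _; exact: lt_le_trans w0 _.
Qed.

Lemma coupled_within_joint d (T : measurableType d) (P : probability T R)
    (f g : T -> R) a b (w : R) : measurable_fun setT f -> measurable_fun setT g ->
  pushforward_of P f a -> pushforward_of P g b ->
  P [set x | w < `|f x - g x|] = 0%E -> coupled_within w a b.
Proof.
move=> mf mg Pfa Pgb Pw; have [pi cpi Ppi] := joint_law_coupling mf mg Pfa Pgb.
by exists pi; rewrite Ppi//; exact: measurable_far_pairs.
Qed.

Lemma coupled_withinC w a b : coupled_within w a b -> coupled_within w b a.
Proof.
move=> [pi [cpi piw]]; apply: (coupled_within_joint measurable_snd measurable_fst
  (coupling_snd cpi) (coupling_fst cpi)).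
by under eq_set do rewrite distrC.
Qed.

Lemma coupled_within_refl a : coupled_within 0 a a.
Proof.
apply: (@coupled_within_joint _ _ a id id) => //.
by under eq_set do rewrite subrr normr0 ltxx; rewrite set_false measure0.
Qed.

Lemma coupled_within_le w a b (A B : set R) : coupled_within w a b ->
  measurable A -> measurable B ->
  (forall x x', `|x - x'| <= w -> A x -> B x') -> (a A <= b B)%E.
Proof.
move=> [pi [cpi piw]] mA mB AB.
rewrite (coupling_fst cpi)// (coupling_snd cpi)//.
have mA1 := measurable_preimageT (@measurable_fst _ _ R R) mA.
have mB2 := measurable_preimageT (@measurable_snd _ _ R R) mB.
have mfar := measurable_far_pairs w.
apply: (@le_trans _ _ (pi (snd @^-1` B `|` [set z | w < `|z.1 - z.2|]))).
  apply: le_measure; rewrite ?inE//; first exact: measurableU.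
  move=> -[x x'] /= Ax; have [near|far] := leP `|x - x'| w; last by right.
  by left; exact: AB near Ax.
by rewrite -[leRHS]adde0 -piw; exact: measureU2.
Qed.

Lemma coupled_within_cdf w a b t : coupled_within w a b ->
  cdfmu a (t - w) <= cdfmu b t.
Proof.
move=> abw; apply: fine_le; rewrite ?fin_num_measure//.
apply: (coupled_within_le abw) => // x x'; rewrite ler_distl => /andP[x'x _].
by rewrite /= !in_itv/=; lra.
Qed.

Lemma coupled_within_bounded w a b (l u : R) : coupled_within w a b ->
  a (~` `[l, u]) = 0%E -> b (~` `[l - w, u + w]) = 0%E.
Proof.
move=> abw alu; apply/eqP; rewrite -measure_le0 -alu.
apply: (coupled_within_le (coupled_withinC abw)); do ?exact: measurableC.
move=> x' x; rewrite ler_distl => /andP[? ?]; apply: contra_not.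
by rewrite /= !in_itv/= => /andP[? ?]; apply/andP; split; lra.
Qed.

Lemma coupled_within_itv a b (l u : R) :
  a (~` `[l, u]) = 0%E -> b (~` `[l, u]) = 0%E -> coupled_within (u - l) a b.
Proof.
move=> alu blu; have mlu : measurable (~` `[l, u]%classic : set R) by exact: measurableC.
pose pi : probability (R * R)%type R := (a \x b)%E.
have cpi : coupling a b pi.
  split => A mA; rewrite [LHS]product_measure1E//= probability_setT.
  - by rewrite mule1.
  - by rewrite mul1e.
exists pi; split => //.
have mfst := measurable_preimageT (@measurable_fst _ _ R R) mlu.
have msnd := measurable_preimageT (@measurable_snd _ _ R R) mlu.
have null_fst : pi (fst @^-1` (~` `[l, u])) = 0%E by rewrite -(coupling_fst cpi).
have null_snd : pi (snd @^-1` (~` `[l, u])) = 0%E by rewrite -(coupling_snd cpi).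
apply: (subset_measure0 (measurable_far_pairs _) (measurableU _ _ mfst msnd)).
  move=> -[x x'] /= far; apply: contrapT => /not_orP[/contrapT + /contrapT].
  rewrite /= !in_itv/= => /andP[? ?] /andP[? ?].
  by move: far; rewrite ltNge => /negP; apply; rewrite ler_distl; apply/andP; split; lra.
exact: etrans (measureU0 mfst msnd null_snd) null_fst.
Qed.

Lemma W1_le_coupled_within w a b : coupled_within w a b -> (W1 a b <= w%:E)%E.
Proof.
move=> [pi [cpi piw]]; rewrite -(integral_cst_probability pi w).
apply: (@le_trans _ _ (\int[pi]_z (`|z.1 - z.2|)%:E)%E).
  by apply: ereal_inf_lbound; exists pi.
apply: (@le_integral_null _ _ _ pi (~` [set z | w < `|z.1 - z.2|])).
- by apply: measurableC; exact: measurable_far_pairs.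
- by rewrite setCK.
- by move=> z /negP; rewrite -leNgt lee_fin.
Qed.

Lemma Winf_ge a b (u : \bar R) :
  (forall w, coupled_within w a b -> (u <= w%:E)%E) -> (u <= Winf a b)%E.
Proof. by move=> uw; apply: le_ereal_inf_tmp => _ [w abw <-]; exact: uw. Qed.

Lemma Winf_le a b w : coupled_within w a b -> (Winf a b <= w%:E)%E.
Proof. by move=> abw; apply: ereal_inf_lbound; exists w. Qed.

Lemma W1_le_Winf a b : (W1 a b <= Winf a b)%E.
Proof. by apply: Winf_ge => w; exact: W1_le_coupled_within. Qed.

Lemma Winf_ge0 a b : (0 <= Winf a b)%E.
Proof. exact: le_trans (W1_ge0 a b) (W1_le_Winf a b). Qed.

Lemma Winf_refl a : Winf a a = 0%E.
Proof. by apply/eqP; rewrite eq_le Winf_ge0 Winf_le//; exact: coupled_within_refl. Qed.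

Lemma W1_refl a : W1 a a = 0%E.
Proof. by apply/eqP; rewrite eq_le W1_ge0 -(Winf_refl a) W1_le_Winf. Qed.

Lemma Winf_fin_num a b (l u : R) :
  a (~` `[l, u]) = 0%E -> b (~` `[l, u]) = 0%E -> Winf a b \is a fin_num.
Proof.
move=> alu blu; rewrite ge0_fin_numE ?Winf_ge0//.
exact: le_lt_trans (Winf_le (coupled_within_itv alu blu)) (ltry _).
Qed.

Lemma W1_fin_num a b (l u : R) :
  a (~` `[l, u]) = 0%E -> b (~` `[l, u]) = 0%E -> W1 a b \is a fin_num.
Proof.
move=> alu blu; rewrite ge0_fin_numE ?W1_ge0//.
by apply: le_lt_trans (W1_le_Winf a b) _; rewrite ltey_eq (Winf_fin_num alu blu).
Qed.

Lemma fine_W1_itv a b (l u : R) : a (~` `[l, u]) = 0%E -> b (~` `[l, u]) = 0%E ->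
  0 <= fine (W1 a b) <= fine (Winf a b).
Proof.
move=> alu blu; rewrite fine_ge0 ?W1_ge0//=.
by apply: fine_le (W1_le_Winf a b); rewrite ?(W1_fin_num alu) ?(Winf_fin_num alu).
Qed.

End Coupling.

(** * Mean distance to finitely many points *)

Section DistTo.
Context (R : realType).
Implicit Types (x y : R) (ys : seq R).

(* [dist_to x [::]] is the distance to the default [head 0 [::] = 0]. *)
Lemma dist_to_le x y ys : y \in head 0 ys :: ys -> dist_to x ys <= `|x - y|.
Proof.
rewrite /dist_to inE => /predU1P[->|y_in]; first exact: bigmin_le_id.
exact: (ge_bigmin_seq _ y xpredT (fun z => `|x - z|) y_in isT).
Qed.

Lemma dist_toP x ys :
  exists2 y, y \in head 0 ys :: ys & dist_to x ys = `|x - y|.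
Proof.
rewrite /dist_to; move: (head 0 ys) => y0.
elim: ys => [|u ys [y y_in yE]].
  by exists y0; rewrite ?big_nil// mem_head.
rewrite big_cons yE; case: (leP `|x - u| `|x - y|) => _.
  by exists u; rewrite // !inE eqxx orbT.
by exists y => //; move: y_in; rewrite !inE => /orP[->|->]; rewrite ?orbT.
Qed.

Lemma dist_to_ge0 x ys : 0 <= dist_to x ys.
Proof. by have [y _ ->] := dist_toP x ys. Qed.

Lemma dist_to_eq0 x ys : (dist_to x ys == 0) = (x \in head 0 ys :: ys).
Proof.
apply/idP/idP => [|x_in].
  by have [y y_in ->] := dist_toP x ys; rewrite normr_eq0 subr_eq0 => /eqP->.
by rewrite eq_le dist_to_ge0 andbT (le_trans (dist_to_le x x_in))// subrr normr0.
Qed.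

Lemma dist_to_lipschitz ys x x' : `|dist_to x ys - dist_to x' ys| <= `|x - x'|.
Proof.
suff lip z z' : dist_to z ys <= dist_to z' ys + `|z - z'|.
  by rewrite ler_distl lip lerBlDr distrC lip.
have [y y_in ->] := dist_toP z' ys; apply: le_trans (dist_to_le z y_in) _.
by rewrite [leRHS]addrC ler_distD.
Qed.

Lemma le_dist_to_map (I : eqType) (r : seq I) (f g : I -> R) x (e : R) :
  0 <= e -> {in r, forall j, `|x - f j| <= `|x - g j| + e} ->
  dist_to x (map f r) <= dist_to x (map g r) + e.
Proof.
case: r => [|i r] e0 fg; first by rewrite lerDl.
have head_in h y : y \in head 0 (map h (i :: r)) :: map h (i :: r) ->
    y \in map h (i :: r).
  by rewrite inE => /predU1P[->|//]; exact: mem_head.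
have [_ /head_in /mapP[j jr ->] ->] := dist_toP x (map g (i :: r)).
by apply: le_trans (fg _ jr); apply: dist_to_le; rewrite inE map_f ?orbT.
Qed.

Lemma measurable_dist_to ys : measurable_fun setT (fun x => dist_to x ys).
Proof.
rewrite /dist_to; elim: {2}ys => [|y zs IH].
  under eq_fun do rewrite big_nil.
  exact: measurable_distance.
under eq_fun do rewrite big_cons.
by apply: measurable_minr => //; exact: measurable_distance.
Qed.

Definition nearest_index ys x := find (fun y => `|x - y| <= dist_to x ys) ys.

Lemma nearest_index_lt ys x : ys != [::] -> (nearest_index ys x < size ys)%N.
Proof.
case: ys => // y0 ys _; rewrite -has_find; apply/hasP.
have [y y_in yE] := dist_toP x (y0 :: ys); exists y; last by rewrite yE.
by move: y_in; rewrite /= !inE orbA orbb.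
Qed.

Definition nearest ys x := nth 0 ys (nearest_index ys x).

Lemma dist_nearest ys x : ys != [::] -> `|x - nearest ys x| = dist_to x ys.
Proof.
move=> ys0; have lt_ys := nearest_index_lt x ys0.
apply/eqP; rewrite eq_le dist_to_le ?andbT; last by rewrite inE mem_nth// orbT.
by have := lt_ys; rewrite -has_find => /(nth_find 0).
Qed.

Lemma measurable_nearest_index ys : measurable_fun setT (nearest_index ys).
Proof.
rewrite /nearest_index; elim: {2}ys => [|y zs IH] /=; first exact: measurable_cst.
apply: measurable_fun_ifT => //.
  by apply: measurable_fun_ler; [exact: measurable_distance|exact: measurable_dist_to].
by apply: measurableT_comp IH.
Qed.

Lemma measurable_nearest ys : measurable_fun setT (nearest ys).
Proof. by apply: measurableT_comp (measurable_nearest_index ys). Qed.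

End DistTo.

Section QuantizationCost.
Context (R : realType).
Implicit Types (a b mu nu lam : probability R R) (ys : seq R).
Local Open Scope ereal_scope.

Definition qcost mu ys : \bar R := \int[mu]_x (dist_to x ys)%:E.

Lemma qcost_ge0 mu ys : 0 <= qcost mu ys.
Proof. by apply: integral_ge0 => x _; rewrite lee_fin dist_to_ge0. Qed.

Lemma qcost_le_W1 a b ys : qcost a ys <= qcost b ys + W1 a b.
Proof.
have [->|b_fin] := eqVneq (qcost b ys) +oo.
  by rewrite addye ?leey// -ltNye (lt_le_trans _ (W1_ge0 a b)).
have {}b_fin : qcost b ys \is a fin_num.
  by rewrite ge0_fin_numE ?qcost_ge0// ltey.
rewrite addeC -leeBlDr//; apply: le_ereal_inf_tmp => _ [pi cpi <-].
rewrite leeBlDr//.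
have mdist := measurable_dist_to ys; have dist_ge0 x := dist_to_ge0 x ys.
have -> : qcost a ys = \int[pi]_z (dist_to z.1 ys)%:E.
  exact: ge0_integral_pushforward_of measurable_fst (coupling_fst cpi) mdist dist_ge0.
have -> : qcost b ys = \int[pi]_z (dist_to z.2 ys)%:E.
  exact: ge0_integral_pushforward_of measurable_snd (coupling_snd cpi) mdist dist_ge0.
rewrite -ge0_integralD//; last first.
- by apply/measurable_EFinP; exact: measurableT_comp mdist measurable_snd.
- by move=> z _; rewrite lee_fin dist_to_ge0.
- by apply/measurable_EFinP; exact: measurable_distance.
apply: (le_integral_null measurableT); first by rewrite setCT measure0.
move=> z _; rewrite -EFinD lee_fin -lerBlDr.
exact: le_trans (ler_norm _) (dist_to_lipschitz ys z.1 z.2).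
Qed.

Lemma qcost_map_le (I : eqType) (r : seq I) mu (f g : I -> R) (e : R) :
  (0 <= e)%R -> {in r, forall j, `|f j - g j| <= e}%R ->
  qcost mu (map f r) <= qcost mu (map g r) + e%:E.
Proof.
move=> e0 fg; rewrite -(integral_cst_probability mu e) -ge0_integralD//; last 2 first.
- by move=> x _; rewrite lee_fin dist_to_ge0.
- by apply/measurable_EFinP; exact: measurable_dist_to.
apply: (le_integral_null measurableT); first by rewrite setCT measure0.
move=> x _; rewrite -EFinD lee_fin; apply: le_dist_to_map => // j jr.
by apply: (le_trans (ler_distD (g j) x (f j))); rewrite lerD2l distrC fg.
Qed.

Lemma qcost_discrete k nu (y w : 'I_k -> R) :
  is_discrete_k nu y w -> qcost nu (codom y) = 0.
Proof.
move=> [_ [_ nuE]]; apply/eqP; rewrite eq_le qcost_ge0 andbT.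
have m0 : measurable [set x | dist_to x (codom y) == 0%R].
  have := measurable_preimageT (measurable_dist_to (codom y)) (measurable_set1 0%R).
  by congr measurable; apply/seteqP; split => x /= /eqP.
rewrite -[leRHS](integral_cst_probability nu 0).
apply: (le_integral_null m0); last by move=> x /eqP->.
rewrite [LHS]nuE; last exact: measurableC.
apply: big1 => j _; rewrite diracE memNset ?mule0//=; apply.
by rewrite dist_to_eq0 inE codom_f orbT.
Qed.

Lemma nearest_law_in_Pk mu ys lam : ys != [::] ->
  pushforward_of mu (nearest ys) lam -> in_Pk (size ys) lam.
Proof.
move=> ys0 muE; pose cell i := nearest_index ys @^-1` [set i].
have mcell i : measurable (cell i).
  exact: measurable_preimageT (measurable_nearest_index ys) _.
have cover : \big[setU/set0]_(i < size ys) cell i = setT.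
  apply/seteqP; split => // x _; rewrite -bigcup_mkord.
  by exists (nearest_index ys x) => //=; exact: nearest_index_lt.
have lamE A : measurable A ->
    lam A = \sum_(i < size ys) (fine (mu (cell i)))%:E * \d_(nth 0%R ys i) A.
  move=> mA; rewrite muE//; set B := nearest ys @^-1` A.
  have mB : measurable B := measurable_preimageT (measurable_nearest ys) mA.
  have -> : B = \big[setU/set0]_(i < size ys) (B `&` cell i).
    by rewrite -big_distrr/= cover setIT.
  rewrite (@measure_bigsetU _ _ _ mu (fun i => B `&` cell i)); last 2 first.
  - by move=> i; exact: measurableI.
  - exact: trivIset_preimage1_in.
  apply: eq_bigr => i _; rewrite fineK ?fin_num_measure// diracE.
  have [iA|iA] := boolP (nth 0%R ys i \in A).
    rewrite mule1; congr (mu _); apply: setIidr => x xi.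
    by rewrite /B /= /nearest xi; exact: set_mem.
  rewrite mule0 (_ : B `&` cell i = set0) ?measure0//.
  apply/seteqP; split => // x [+ xi].
  by rewrite /B /= /nearest xi => /mem_set; rewrite (negbTE iA).
exists (fun i => nth 0%R ys i), (fun i : 'I_(size ys) => fine (mu (cell i))).
split => [j|]; first exact: fine_ge0.
split => //; apply: EFin_inj; rewrite -sumEFin -(@probability_setT _ _ _ lam) lamE//.
by apply: eq_bigr => i _; rewrite diracT mule1.
Qed.

Lemma W1_le_qcost mu ys : ys != [::] ->
  exists2 lam : probability R R, in_Pk (size ys) lam & W1 mu lam <= qcost mu ys.
Proof.
move=> ys0; have mnearest := measurable_nearest ys.
have [lam muE] := pushforward_exists mu mnearest.
exists lam; first exact: nearest_law_in_Pk ys0 muE.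
rewrite /qcost; under eq_integral do rewrite -dist_nearest//.
exact: (W1_le_joint (f := id)).
Qed.

Definition optimal_points mu k ys :=
  size ys = k /\ forall zs, size zs = k -> qcost mu ys <= qcost mu zs.

Lemma W1_opt_qcost k mu nu (y w : 'I_k -> R) : (0 < k)%N -> W1_opt k mu nu ->
  is_discrete_k nu y w ->
  W1 mu nu = qcost mu (codom y) /\ optimal_points mu k (codom y).
Proof.
move=> k0 [_ nuopt] nud; have size_y : size (codom y) = k by rewrite size_codom card_ord.
have W1_le zs : size zs = k -> W1 mu nu <= qcost mu zs.
  move=> zk; have [|lam lamk lamle] := @W1_le_qcost mu zs.
    by rewrite -size_eq0 zk -lt0n.
  by apply: le_trans lamle; apply: nuopt; rewrite -zk.
have qcost_le : qcost mu (codom y) <= W1 mu nu.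
  by have := qcost_le_W1 mu nu (codom y); rewrite (qcost_discrete nud) add0e.
split; first by apply/eqP; rewrite eq_le qcost_le W1_le.
by split => // zs zk; apply: le_trans qcost_le (W1_le _ zk).
Qed.

Lemma qcost_gt0 mu ys : (forall x, mu [set x] = 0) -> 0 < qcost mu ys.
Proof.
move=> mu1; rewrite lt_neqAle qcost_ge0 andbT eq_sym; apply/eqP => q0.
pose pts := head 0%R ys :: ys.
have pts_null : mu.-negligible [set` pts].
  elim: pts => [|y zs IH]; first by rewrite set_nil; exact: negligible_set0.
  apply: (negligibleS _ (negligibleU (_ : mu.-negligible [set y]) IH)).
    by move=> x /=; rewrite inE => /predU1P.
  by apply/negligibleP => //; exact: mu1.
have mdist : measurable_fun setT (fun x : R => (dist_to x ys)%:E).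
  by apply/measurable_EFinP; exact: measurable_dist_to.
have off_pts_null : mu.-negligible (~` [set` pts]).
  have /(ae_eq_integral_abs _ measurableT mdist) : \int[mu]_x `|(dist_to x ys)%:E| = 0.
    rewrite -[RHS]q0; apply: eq_integral => x _.
    by rewrite gee0_abs// lee_fin dist_to_ge0.
  apply: negligibleS => x /= /negP x_notin /(_ Logic.I)[] /eqP.
  by rewrite dist_to_eq0 (negbTE x_notin).
suff : mu setT = 0 by rewrite probability_setT => /eqP; rewrite onee_eq0.
by apply/negligibleP => //; rewrite -(setUv [set` pts]); exact: negligibleU.
Qed.

Lemma integrable_dist_to mu ys (l u : R) : mu (~` `[l, u]) = 0 ->
  mu.-integrable setT (EFin \o (fun x => dist_to x ys)).
Proof.
move=> mulu; apply: (bounded_integrable_null (measurable_itv _) mulu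
  (measurable_dist_to ys)) => x.
rewrite /= in_itv/= => /andP[lx xu]; rewrite ger0_norm ?dist_to_ge0//.
have := dist_to_lipschitz ys x l; rewrite (ger0_norm (_ : (0 <= x - l)%R)) ?subr_ge0//.
move=> /(le_trans (ler_norm _)); rewrite lerBlDr => /le_trans; apply.
exact: (lerD (lerB xu (lexx l)) (lexx (dist_to l ys))).
Qed.

Lemma qcost_fin_num mu ys (l u : R) : mu (~` `[l, u]) = 0 -> qcost mu ys \is a fin_num.
Proof. by move=> /(integrable_dist_to ys); exact: integrable_fin_num. Qed.

End QuantizationCost.

(** * Laws with a density on an interval *)

Section Cdf.
Context (R : realType) (mu : probability R R).
Local Notation F := (cdfmu mu).

Lemma cdfmu_ge0 x : 0 <= F x.
Proof. by rewrite fine_ge0. Qed.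

Lemma cdfmu_le1 x : F x <= 1.
Proof. by rewrite -lee_fin fineK ?fin_num_measure//; exact: probability_le1. Qed.

Lemma cdfmu_itv01 x : 0 <= F x <= 1.
Proof. by rewrite cdfmu_ge0 cdfmu_le1. Qed.

Lemma cdfmuB s t : s <= t -> F t - F s = fine (mu `]s, t]%classic).
Proof.
move=> st; apply/eqP; rewrite subr_eq addrC; apply/eqP.
rewrite /cdfmu (@itv_bndbnd_setU _ _ -oo%O (BRight s))//.
rewrite measureU//; first by rewrite fineD// fin_num_measure.
apply/seteqP; split => x //= -[]; rewrite !in_itv/= => xs /andP[sx _].
by move: (le_lt_trans xs sx); rewrite ltxx.
Qed.

Lemma cdfmu_le s t : s <= t -> F s <= F t.
Proof. by move=> st; rewrite -subr_ge0 cdfmuB// fine_ge0. Qed.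

Lemma cdfmu_left a b : mu [set a] = 0%E -> mu (~` `[a, b]) = 0%E -> F a = 0.
Proof.
move=> mua muab; have mab : measurable (~` `[a, b]%classic : set R) by exact: measurableC.
have null : mu ([set a] `|` ~` `[a, b]) = 0%E by rewrite measureU0.
rewrite /cdfmu (subset_measure0 _ _ _ null)//; first exact: measurableU.
move=> x /=; rewrite !in_itv/= => xa; have [->|xna] := eqVneq x a; first by left.
by right => /andP[ax _]; move: xna; rewrite eq_le xa ax.
Qed.

Lemma cdfmu_right a b : mu (~` `[a, b]) = 0%E -> F b = 1.
Proof.
move=> muab; have mb : measurable (~` `]-oo, b]%classic : set R) by exact: measurableC.
have null : mu (~` `]-oo, b]) = 0%E.
  apply: (subset_measure0 _ _ _ muab) => //; first exact: measurableC.
  by apply: subsetC => x /=; rewrite !in_itv/= => /andP[].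
have muT : mu setT = mu `]-oo, b]%classic by rewrite -[RHS](measureU0 _ mb null)// setUv.
by rewrite /cdfmu -muT probability_setT.
Qed.

Lemma cdfmu_separated a b : {in `[a, b] &, {homo F : s t / s < t}} ->
  forall q r, q \in `[a, b] -> 0 < r -> exists2 g, 0 < g &
    {in `[a, b], forall t, r <= `|t - q| -> g <= `|F t - F q|}.
Proof.
move=> Flt q r; rewrite in_itv/= => /andP[aq qb] r0.
pose up := if q + r <= b then F (q + r) - F q else 1.
pose dn := if a <= q - r then F q - F (q - r) else 1.
exists (Num.min up dn).
  rewrite lt_min; apply/andP; split; rewrite /up /dn; case: ifP => // le_ab;
    by rewrite subr_gt0; apply: Flt; rewrite ?in_itv/=; lra.
move=> t; rewrite in_itv/= ge_min => /andP[a_t tb]; have [qt|tq] := leP q t.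
  rewrite ger0_norm ?subr_ge0// => rt; apply/orP; left; rewrite /up ifT; last by lra.
  by rewrite ger0_norm ?subr_ge0 ?cdfmu_le// lerB// cdfmu_le//; lra.
rewrite ltr0_norm ?subr_lt0// opprB => rt; apply/orP; right; rewrite /dn ifT; last by lra.
rewrite ler0_norm ?subr_le0 ?cdfmu_le ?(ltW tq)// opprB lerB// cdfmu_le//; lra.
Qed.

End Cdf.

Section Support.
Context (R : realType) (mu : probability R R).

(* Lindelöf: the complement of the support is covered by the countably many
   null intervals with rational endpoints. *)
Lemma spt_setC_negligible : mu.-negligible (~` spt mu).
Proof.
pose ratitv n : set R := if unpickle n is Some (p, q) then
  `](ratr p : R), (ratr q : R)[%classic else set0.
pose null_itv n := if mu (ratitv n) == 0%E then ratitv n else set0.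
apply: (@negligibleS _ _ _ mu (\bigcup_n null_itv n)); last first.
  apply: negligible_bigcup => n; exists (null_itv n).
  rewrite /null_itv; case: eqP => // muI; split => //.
  by rewrite /ratitv; case: unpickle => [[p q]|].
move=> x /existsNP[U /not_implyP[oU /not_implyP[Ux /negP]]].
rewrite -leNgt => muU.
have /nbhs_ballP[e /= e0 eU] := open_nbhs_nbhs (conj oU Ux).
have [|p] := @rat_in_itvoo R (x - e) x; first by rewrite ltrBlDr ltrDl.
have [|q] := @rat_in_itvoo R x (x + e); first by rewrite ltrDl.
rewrite !in_itv/= => /andP[xq qe] /andP[ep px].
have pqU : `](ratr p : R), (ratr q : R)[ `<=` U.
  move=> z /=; rewrite in_itv/= => /andP[pz zq]; apply: eU.
  by rewrite /ball/= ltr_distl; apply/andP; split; lra.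
exists (pickle (p, q)) => //; rewrite /null_itv /ratitv pickleK ifT/=.
  by rewrite in_itv/= px xq.
rewrite -measure_le0; apply: le_trans muU.
by apply: le_measure; rewrite ?inE//; exact: open_measurable.
Qed.

Lemma spt_cdfmu_lt s t x : spt mu x -> s < x -> x < t -> cdfmu mu s < cdfmu mu t.
Proof.
move=> x_spt sx xt; rewrite -subr_gt0 cdfmuB ?(ltW (lt_trans sx xt))//.
apply: fine_gt0; rewrite ltey_eq fin_num_measure//= andbT.
apply: lt_le_trans (x_spt `]s, t[%classic (interval_open _ _) _) _ => //.
  by rewrite /= in_itv/= sx xt.
apply: le_measure; rewrite ?inE//.
by move=> z /=; rewrite !in_itv/= => /andP[-> /ltW].
Qed.

End Support.

Section DerivativeBound.
Context (R : realType).

Lemma derivable_within_ge_half (rho : R -> R) (a b q l : R) : 0 < rho q ->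
  ((fun y => (rho y - rho q) / (y - q)) @
     within [set y | y \in `[a, b] /\ y != q] (nbhs q)) --> l ->
  exists2 e, 0 < e & {in `[a, b], forall t, `|t - q| < e -> rho q / 2 <= rho t}.
Proof.
move=> rho_q /cvgr_norm_lt/(_ (`|l| + 1)); rewrite ltrDl => /(_ ltr01).
set K := `|l| + 1; have K0 : 0 < K by rewrite ltr_wpDl.
rewrite near_withinE => /nbhs_ballP[e0 /= e00 slope_lt].
pose e := Num.min e0 (rho q / 2 / K); have e_gt0 : 0 < e by rewrite lt_min e00 !divr_gt0.
exists e => // t t_ab; rewrite lt_min => /andP[te0 teK].
have [->|tq] := eqVneq t q; first by lra.
have := slope_lt t; rewrite /ball/= distrC te0 => /(_ isT (conj t_ab tq)).
rewrite normrM normfV ltr_pdivrMr ?normr_gt0 ?subr_eq0// => rho_lt.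
have : K * `|t - q| < rho q / 2 by rewrite mulrC -ltr_pdivlMr.
by move=> /(lt_trans rho_lt); rewrite ltr_distl => /andP[? _]; lra.
Qed.

End DerivativeBound.

Section Density.
Context (R : realType) (mu : probability R R) (rho : R -> R).
Hypotheses (mrho : measurable_fun setT rho) (rho_ge0 : forall x, 0 <= rho x).
Hypothesis muE : forall A, measurable A ->
  mu A = (\int[lebesgue_measure]_(x in A) (rho x)%:E)%E.
Local Notation F := (cdfmu mu).

Lemma density_set1 x : mu [set x] = 0%E.
Proof. by rewrite muE// integral_set1. Qed.

Lemma density_cdfmu_ge (m s t : R) : 0 <= m -> s <= t ->
  {in `]s, t], forall x, m <= rho x} -> m * (t - s) <= F t - F s.
Proof.
move=> m0 st m_rho; rewrite cdfmuB// -lee_fin fineK ?fin_num_measure// muE//.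
have -> : (m * (t - s))%:E = (\int[lebesgue_measure]_(x in `]s, t]) m%:E)%E.
  rewrite integral_cst//= lebesgue_measure_itv/= lte_fin.
  have [_|ts] := ltP s t; first by rewrite EFinM EFinB.
  by have -> : s = t; [apply/eqP; rewrite eq_le st|rewrite subrr mulr0 mule0].
by apply: ge0_le_integral => //; exact/measurable_EFinP/measurable_funTS.
Qed.

Lemma density_cdfmu_quantile a b v : a <= b -> mu (~` `[a, b]) = 0%E ->
  0 <= v <= 1 -> exists2 q, q \in `[a, b] & F q = v.
Proof.
move=> ab muab v01.
have FE x : a <= x -> F x = parameterized_integral lebesgue_measure a x rho.
  move=> ax; have muax : mu `[a, x]%classic = mu `]a, x]%classic.
    have <- := @setU1itv _ _ (BRight x) a false ax; rewrite setUC.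
    exact: measureU0 (measurable_itv _) (measurable_set1 a) (density_set1 a).
  have := cdfmuB mu ax; rewrite (cdfmu_left (density_set1 a) muab) subr0 => ->.
  by rewrite -muax muE.
have rho_int : lebesgue_measure.-integrable `[a, b] (EFin \o rho).
  apply/integrableP; split; first exact/measurable_EFinP/measurable_funTS.
  under eq_integral do rewrite /= ger0_norm//.
  by rewrite -muE// (le_lt_trans (probability_le1 mu _))// ltry.
have [|q] := IVT (v := v) ab (parameterized_integral_continuous ab rho_int).
  rewrite /= -!FE// (cdfmu_left (density_set1 a) muab) (cdfmu_right muab).
  by rewrite min_l ?max_r.
by move=> qab <-; exists q => //; rewrite FE//; move: qab; rewrite in_itv => /andP[].
Qed.

(* Near [q] the density is at least half its value at [q]; away from [q] the
   increments of the c.d.f. are bounded below, hence linearly in a bounded range. *)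
Lemma density_cdfmu_slope (a b q l : R) : {in `[a, b] &, {homo F : s t / s < t}} ->
  a < b -> q \in `[a, b] -> 0 < rho q ->
  ((fun y => (rho y - rho q) / (y - q)) @
     within [set y | y \in `[a, b] /\ y != q] (nbhs q)) --> l ->
  exists2 m, 0 < m &
    {in `[a, b], forall t, m * `|t - q| <= `|F t - F q|}.
Proof.
move=> Flt ab q_ab rho_q rho_l.
have [e e0 rho_ge] := derivable_within_ge_half rho_q rho_l.
have [g g0 g_le] := cdfmu_separated Flt q_ab e0.
have r0 : 0 <= rho q / 2 by rewrite divr_ge0 ?ltW.
have ba0 : 0 < b - a by rewrite subr_gt0.
exists (Num.min (rho q / 2) (g / (b - a))); first by rewrite lt_min !divr_gt0.
move=> t t_ab; have [far|near] := leP e `|t - q|.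
  apply: le_trans (g_le t t_ab far).
  have tq_ba : `|t - q| <= b - a.
    by move: t_ab q_ab; rewrite !in_itv/= ler_distl => /andP[? ?] /andP[? ?]; lra.
  rewrite -[leRHS](divfK (lt0r_neq0 ba0)); apply: ler_pM => //.
  - by rewrite le_min r0 divr_ge0 ?ltW.
  - by rewrite ge_min lexx orbT.
apply: (@le_trans _ _ (rho q / 2 * `|t - q|)).
  by rewrite ler_wpM2r// ge_min lexx.
move: t_ab q_ab; rewrite !in_itv/= => /andP[a_t tb] /andP[aq qb].
have rho_between x : (q <= x <= t) || (t <= x <= q) -> rho q / 2 <= rho x.
  move: near; rewrite ltr_distl => /andP[qt tq].
  by move=> /orP[]/andP[? ?]; apply: rho_ge; rewrite ?in_itv/= ?ltr_distl; lra.
have [qt|tq] := leP q t.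
  rewrite !ger0_norm ?subr_ge0 ?cdfmu_le//; apply: density_cdfmu_ge => // x.
  by rewrite in_itv/= => /andP[/ltW qx xt]; apply: rho_between; rewrite qx xt.
rewrite distrC [leRHS]distrC !ger0_norm ?subr_ge0 ?cdfmu_le ?(ltW tq)//.
apply: density_cdfmu_ge => // [|x]; first exact: ltW.
by rewrite in_itv/= => /andP[/ltW tx xq]; apply: rho_between; rewrite tx xq orbT.
Qed.

End Density.

Section RegularLaw.
Context (R : realType).

Record regular_law (mu : probability R R) (a b : R) : Prop := RegularLaw {
  regular_lt : a < b;
  regular_set1 : forall x, mu [set x] = 0%E;
  regular_null : mu (~` `[a, b]) = 0%E;
  regular_cdf_lt : {in `[a, b] &, {homo cdfmu mu : s t / s < t}};
  regular_quantile : forall v, 0 <= v <= 1 ->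
    exists2 q, q \in `[a, b] & cdfmu mu q = v;
  regular_slope : forall q, q \in `]a, b[ -> exists2 m, 0 < m &
    {in `[a, b], forall t, m * `|t - q| <= `|cdfmu mu t - cdfmu mu q|} }.

Lemma regular_cdf0 mu a b : regular_law mu a b -> cdfmu mu a = 0.
Proof. by move=> reg; exact: cdfmu_left (regular_set1 reg a) (regular_null reg). Qed.

Lemma regular_cdf1 mu a b : regular_law mu a b -> cdfmu mu b = 1.
Proof. by move=> reg; exact: cdfmu_right (regular_null reg). Qed.

Lemma standing_regular (mu : probability R R) :
  standing mu -> exists a b, regular_law mu a b.
Proof.
move=> [rho [mrho [rho_ge0 [muE [a [b [ab [sptE [rho_gt0 rho_diff]]]]]]]]].
have muab : mu (~` `[a, b]) = 0%E.
  apply/negligibleP; first exact: measurableC.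
  by rewrite -sptE; exact: spt_setC_negligible.
have Flt : {in `[a, b] &, {homo cdfmu mu : s t / s < t}}.
  move=> s t; rewrite !in_itv/= => /andP[a_s _] /andP[_ tb] st.
  apply: (@spt_cdfmu_lt _ _ _ _ ((s + t) / 2)); [|lra|lra].
  by rewrite sptE /= in_itv/=; apply/andP; split; lra.
exists a, b; split => //.
- exact: density_set1 muE.
- by move=> v; exact: density_cdfmu_quantile mrho rho_ge0 muE _ _ v (ltW ab) muab.
- move=> q q_oo; have q_ab := subset_itv_oo_cc q_oo; have [l rho_l] := rho_diff q q_ab.
  apply: (density_cdfmu_slope mrho muE Flt ab q_ab _ rho_l).
  by apply: rho_gt0; rewrite in_itv in q_oo.
Qed.

End RegularLaw.

(** * Mean distance to transported quantiles *)

Section Clip.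
Context (R : realType).

Definition clip (l u t : R) : R := Num.max l (Num.min t u).

Lemma clip_dist_le l u t x : x \in `[l, u] -> `|x - clip l u t| <= `|x - t|.
Proof.
rewrite /clip in_itv/= => /andP[lx xu]; have [tu|ut] := leP t u.
  have [//|tl] := leP l t; rewrite !ger0_norm ?subr_ge0//; first lra.
  by rewrite ltW// (lt_le_trans tl).
have [lu|?] := leP l u; last by lra.
by rewrite distrC [leRHS]distrC !ger0_norm ?subr_ge0//; lra.
Qed.

Lemma qcost_clip_le (mu : probability R R) l u ys : mu (~` `[l, u]) = 0%E ->
  (qcost mu (map (clip l u) ys) <= qcost mu ys)%E.
Proof.
move=> mulu; apply: (le_integral_null (measurable_itv _) mulu) => x xlu.
rewrite lee_fin -[leRHS]addr0 -[in leRHS](map_id ys).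
by apply: le_dist_to_map => // y _; rewrite addr0; exact: clip_dist_le.
Qed.

End Clip.

Section QuantileCost.
Context (R : realType).
Implicit Types (mu mut : probability R R) (ys : seq R).

Lemma regular_ge_of_cdf mu a b s q : regular_law mu a b -> q \in `[a, b] ->
  cdfmu mu s <= cdfmu mu q -> Num.min s b <= q.
Proof.
move=> reg q_ab; apply: contra_le; rewrite lt_min => /andP[qs qb].
apply: (@lt_le_trans _ _ (cdfmu mu (Num.min s b))).
  apply: (regular_cdf_lt reg) => //; last by rewrite lt_min qs.
  move: q_ab; rewrite !in_itv/= ge_min le_min lexx orbT andbT => /andP[aq _].
  by rewrite !(le_trans aq) ?ltW.
by rewrite cdfmu_le// ge_min lexx.
Qed.

Lemma regular_le_of_cdf mu a b s q : regular_law mu a b -> q \in `[a, b] ->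
  cdfmu mu q <= cdfmu mu s -> q <= Num.max s a.
Proof.
move=> reg q_ab; apply: contra_le; rewrite gt_max => /andP[sq aq].
apply: (@le_lt_trans _ _ (cdfmu mu (Num.max s a))).
  by rewrite cdfmu_le// le_max lexx.
apply: (regular_cdf_lt reg) => //; last by rewrite gt_max sq.
move: q_ab; rewrite !in_itv/= le_max ge_max lexx orbT/= => /andP[_ qb].
by rewrite !(le_trans _ qb) ?ltW.
Qed.

Lemma quantile_near_clip mu mut a b w q t : regular_law mu a b ->
  coupled_within w mu mut -> q \in `[a, b] -> cdfmu mu q = cdfmu mut t ->
  `|q - clip (a - w) (b + w) t| <= w.
Proof.
move=> reg mu_mut q_ab qF; have w0 := coupled_within_ge0 mu_mut.
have := coupled_within_cdf t mu_mut; rewrite -qF => /(regular_ge_of_cdf reg q_ab).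
have := coupled_within_cdf (t + w) (coupled_withinC mu_mut).
rewrite addrK -qF => /(regular_le_of_cdf reg q_ab).
move: q_ab; rewrite in_itv/= ge_min le_max ler_distl /clip => /andP[aq qb].
by case: (leP t (b + w)) => ?; case: (leP (a - w)) => ?; move=> /orP[]? /orP[]?;
  apply/andP; split; lra.
Qed.

Lemma qcost_quantile_le_coupled mu mut a b k (q : R -> R) zs ys w :
  regular_law mu a b ->
  (forall z, q z \in `[a, b] /\ cdfmu mu (q z) = cdfmu mut z) ->
  optimal_points mut k zs -> size ys = k -> coupled_within w mu mut ->
  (qcost mu (map q zs) <= qcost mu ys + W1 mu mut + W1 mu mut + w%:E)%E.
Proof.
move=> reg qP [_ zs_opt] ysk mu_mut; pose cl := clip (a - w) (b + w).
have shift : (qcost mu (map q zs) <= qcost mu (map cl zs) + w%:E)%E.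
  apply: qcost_map_le => [|z _]; first exact: coupled_within_ge0 mu_mut.
  by have [q_ab qF] := qP z; exact: quantile_near_clip reg mu_mut q_ab qF.
have clipped : (qcost mut (map cl zs) <= qcost mut zs)%E.
  exact/qcost_clip_le/(coupled_within_bounded mu_mut (regular_null reg)).
apply: (le_trans shift); rewrite leeD2r//.
apply: (le_trans (qcost_le_W1 mu mut _)); rewrite leeD2r//.
apply: (le_trans clipped); apply: (le_trans (zs_opt ys ysk)).
by rewrite [X in (_ + X)%E]W1C; exact: qcost_le_W1.
Qed.

Lemma exists_quantile_points mu mut a b l u k ys zs : regular_law mu a b ->
  mu (~` `[l, u]) = 0%E -> mut (~` `[l, u]) = 0%E ->
  size ys = k -> optimal_points mut k zs ->
  exists qs, [/\ size qs = k, {subset qs <= `[a, b]},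
    map (cdfmu mut) zs = map (cdfmu mu) qs &
    fine (qcost mu qs) <=
      fine (qcost mu ys) + (fine (Winf mu mut) + 2 * fine (W1 mu mut))].
Proof.
move=> reg mulu mutlu ysk zs_opt.
have /choice[q qP] : forall z, exists x, x \in `[a, b] /\ cdfmu mu x = cdfmu mut z.
  by move=> z; have [x x_ab xF] := regular_quantile reg (cdfmu_itv01 mut z); exists x.
exists (map q zs); split.
- by rewrite size_map; exact: zs_opt.1.
- by move=> _ /mapP[z _ ->]; exact: (qP z).1.
- by rewrite -map_comp; apply: eq_map => z; rewrite /= (qP z).2.
have Wfin := Winf_fin_num mulu mutlu; have W1fin := W1_fin_num mulu mutlu.
suff : ((fine (qcost mu (map q zs)) - fine (qcost mu ys) - 2 * fine (W1 mu mut))%:E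
    <= Winf mu mut)%E by rewrite -[X in (_ <= X)%E]fineK// lee_fin; lra.
apply: Winf_ge => w mu_mut.
have := qcost_quantile_le_coupled reg qP zs_opt ysk mu_mut.
rewrite -(fineK (qcost_fin_num (map q zs) mulu)) -(fineK (qcost_fin_num ys mulu)).
rewrite -(fineK W1fin) -!EFinD !lee_fin; lra.
Qed.

End QuantileCost.

(** * Means over i.i.d. samples *)

Section IidMean.
Context (R : realType) (mu : probability R R).
Implicit Types (f g : seq R -> R).

(* [Eiid] is additive only when the integrand is integrable at every stage, which
   [iid_mean] records along with the value. *)
Fixpoint iid_mean n f (m : R) : Prop :=
  match n with
  | 0 => f [::] = m
  | n'.+1 => exists G : R -> R, [/\ mu.-integrable setT (EFin \o G),
      forall x, iid_mean n' (fun s => f (x :: s)) (G x) & \int[mu]_x G x = m]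
  end.

Lemma iid_mean_Eiid n f m : iid_mean n f m -> Eiid mu n f = m%:E.
Proof.
elim: n f m => [|n IH] f m /=; first by rewrite /Eiid/= => ->.
case=> G [iG fG <-]; rewrite /Eiid /Rintegral fineK; last exact: integrable_fin_num.
by apply: eq_integral => x _; exact: IH (fG x).
Qed.

Lemma iid_mean_ext n f g m : (forall s, size s = n -> f s = g s) ->
  iid_mean n f m -> iid_mean n g m.
Proof.
elim: n f g m => [|n IH] f g m fg /=; first by rewrite fg.
move=> [G [iG fG EG]]; exists G; split => // x.
by apply: IH (fG x) => s sn; apply: fg; rewrite /= sn.
Qed.

Lemma iid_mean_cst n (r : R) : iid_mean n (fun=> r) r.
Proof.
elim: n => [//|n IH] /=; exists (fun=> r); split => //.
  exact: finite_measure_integrable_cst.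
exact: Rintegral_cst_probability.
Qed.

Lemma iid_meanD n f g m p : iid_mean n f m -> iid_mean n g p ->
  iid_mean n (fun s => f s + g s) (m + p).
Proof.
elim: n f g m p => [|n IH] f g m p /=; first by move=> -> ->.
move=> [F [iF fF <-]] [G [iG gG <-]]; exists (fun x => F x + G x); split.
- exact: (integrableD measurableT iF iG).
- by move=> x; exact: IH.
- exact: RintegralD.
Qed.

Lemma iid_meanZ n (r : R) f m : iid_mean n f m -> iid_mean n (fun s => r * f s) (r * m).
Proof.
elim: n f m => [|n IH] f m /=; first by move=> ->.
move=> [F [iF fF <-]]; exists (fun x => r * F x); split.
- exact: (integrableZl measurableT _ iF).
- by move=> x; exact: IH.
- exact: RintegralZl.
Qed.

Lemma iid_meanB n f g m p : iid_mean n f m -> iid_mean n g p ->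
  iid_mean n (fun s => f s - g s) (m - p).
Proof.
move=> fm /(iid_meanZ (-1)); rewrite mulN1r => /(iid_meanD fm).
by apply: iid_mean_ext => s _; rewrite mulN1r.
Qed.

Lemma iid_mean_sum_fun n (h : R -> R) : mu.-integrable setT (EFin \o h) ->
  iid_mean n (fun s => \sum_(x <- s) h x) (n%:R * \int[mu]_x h x).
Proof.
move=> ih; elim: n => [|n IH] /=; first by rewrite big_nil mul0r.
set m := n%:R * _ in IH *.
have im : mu.-integrable setT (EFin \o cst m) by exact: finite_measure_integrable_cst.
exists (fun x => h x + m); split.
- exact: (integrableD measurableT ih im).
- move=> x; apply: iid_mean_ext (iid_meanD (iid_mean_cst n (h x)) IH) => s _.
  by rewrite big_cons.
- by rewrite RintegralD// Rintegral_cst_probability -natr1 mulrDl mul1r addrC.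
Qed.

Lemma iid_mean_sqr_sum n (h : R -> R) (r : R) : mu.-integrable setT (EFin \o h) ->
  \int[mu]_x h x = 0 -> mu.-integrable setT (fun x => (h x ^+ 2)%:E) ->
  iid_mean n (fun s => (r + \sum_(x <- s) h x) ^+ 2)
    (r ^+ 2 + n%:R * \int[mu]_x (h x ^+ 2)).
Proof.
move=> ih h0 ih2; set v := \int[mu]_x _; elim: n r => [|n IH] r /=.
  by rewrite big_nil addr0 mul0r addr0.
have i_lin := integrableZl measurableT (2 * r) ih.
have i_cst : mu.-integrable setT (EFin \o cst (r ^+ 2 + n%:R * v)).
  exact: finite_measure_integrable_cst.
have i_quad := integrableD measurableT ih2 i_lin.
have expand x : (r + h x) ^+ 2 + n%:R * v = h x ^+ 2 + 2 * r * h x + (r ^+ 2 + n%:R * v).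
  by ring.
exists (fun x => h x ^+ 2 + 2 * r * h x + (r ^+ 2 + n%:R * v)); split.
- exact: (integrableD measurableT i_quad i_cst).
- move=> x; rewrite -expand; apply: iid_mean_ext (IH (r + h x)) => s _.
  by rewrite big_cons addrA.
- rewrite RintegralD// RintegralD// RintegralZl// h0 mulr0 addr0.
  by rewrite Rintegral_cst_probability -natr1 -/v; ring.
Qed.

End IidMean.

Section SampleMean.
Context (R : realType) (mu : probability R R).
Implicit Types (g h : R -> R) (s : seq R).

Definition sample_mean g s : R := (size s)%:R^-1 * \sum_(x <- s) g x.

Definition discrepancy g s : R := sample_mean g s - \int[mu]_x g x.

Lemma le_sample_mean g h s : {in s, forall x, g x <= h x} ->
  sample_mean g s <= sample_mean h s.
Proof.
by move=> gh; rewrite ler_wpM2l ?invr_ge0// big_seq [leRHS]big_seq ler_sum.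
Qed.

Lemma sample_meanD g h s :
  sample_mean (fun x => g x + h x) s = sample_mean g s + sample_mean h s.
Proof. by rewrite /sample_mean big_split mulrDr. Qed.

Lemma sample_meanZ (r : R) g s : sample_mean (fun x => r * g x) s = r * sample_mean g s.
Proof. by rewrite /sample_mean -mulr_sumr mulrCA. Qed.

Lemma sample_mean_cst (r : R) s : (0 < size s)%N -> sample_mean (fun=> r) s = r.
Proof.
move=> s0; rewrite /sample_mean big_const_seq count_predT iter_addr_0.
by rewrite -[r *+ _]mulr_natl mulKf// pnatr_eq0 -lt0n.
Qed.

Lemma discrepancyD g h s : mu.-integrable setT (EFin \o g) ->
  mu.-integrable setT (EFin \o h) ->
  discrepancy (fun x => g x + h x) s = discrepancy g s + discrepancy h s.
Proof. by move=> ig ih; rewrite /discrepancy sample_meanD RintegralD//; ring. Qed.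

Lemma discrepancyZ (r : R) g s : mu.-integrable setT (EFin \o g) ->
  discrepancy (fun x => r * g x) s = r * discrepancy g s.
Proof. by move=> ig; rewrite /discrepancy sample_meanZ RintegralZl// mulrBr. Qed.

Lemma discrepancy_cst (r : R) s : (0 < size s)%N -> discrepancy (fun=> r) s = 0.
Proof.
by move=> s0; rewrite /discrepancy sample_mean_cst// Rintegral_cst_probability subrr.
Qed.

Lemma iid_mean_sample_mean n g : (0 < n)%N -> mu.-integrable setT (EFin \o g) ->
  iid_mean mu n (sample_mean g) (\int[mu]_x g x).
Proof.
move=> n0 /(iid_mean_sum_fun n)/(iid_meanZ n%:R^-1).
rewrite mulKf ?pnatr_eq0 -?lt0n//; apply: iid_mean_ext => s sn.
by rewrite /sample_mean sn.
Qed.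

Lemma iid_mean_sqr_discrepancy n g : (0 < n)%N -> mu.-integrable setT (EFin \o g) ->
  mu.-integrable setT (fun x => ((g x - \int[mu]_y g y) ^+ 2)%:E) ->
  iid_mean mu n (fun s => discrepancy g s ^+ 2)
    ((\int[mu]_x (g x - \int[mu]_y g y) ^+ 2) / n%:R).
Proof.
move=> n0 ig; set m := \int[mu]_y g y => ig2.
have im : mu.-integrable setT (EFin \o cst (- m)) by exact: finite_measure_integrable_cst.
have i_cen : mu.-integrable setT (EFin \o (fun x => g x - m)).
  exact: (integrableD measurableT ig im).
have cen0 : \int[mu]_x (g x - m) = 0.
  by rewrite RintegralD// Rintegral_cst_probability subrr.
have := iid_mean_sqr_sum n 0 i_cen cen0 ig2; move=> /(iid_meanZ (n%:R^-1 ^+ 2)).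
have n_neq0 : n%:R != 0 :> R by rewrite pnatr_eq0 -lt0n.
have -> : n%:R^-1 ^+ 2 * (0 ^+ 2 + n%:R * \int[mu]_x (g x - m) ^+ 2) =
    (\int[mu]_x (g x - m) ^+ 2) / n%:R by field.
apply: iid_mean_ext => s sn; rewrite add0r -exprMn; congr (_ ^+ 2).
have s0 : (0 < size s)%N by rewrite sn.
by rewrite -sn -/(sample_mean _ _) sample_meanD sample_mean_cst.
Qed.

Definition ecdf s t : R := (count (fun x => x <= t) s)%:R / (size s)%:R.

Lemma discrepancy_itvNyc t s :
  discrepancy (\1_(`]-oo, t]%classic)) s = ecdf s t - cdfmu mu t.
Proof.
rewrite /discrepancy /Rintegral integral_indic// setIT; congr (_ - _).
rewrite /sample_mean /ecdf mulrC -sum1_count natr_sum [in RHS]big_mkcond/=; congr (_ / _).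
by apply: eq_bigr => x _; rewrite indicE mem_setE in_itv/=; case: ifP.
Qed.

Lemma integrable_itvNyc t : mu.-integrable setT (EFin \o \1_(`]-oo, t]%classic)).
Proof. exact: integrable_indic. Qed.

End SampleMean.

Section MeanLe.
Context (R : realType) (mu : probability R R) (a b : R).
Hypothesis muab : mu (~` `[a, b]) = 0%E.
Implicit Types (f g e : seq R -> R) (s : seq R).

Definition sample n s := size s = n /\ {subset s <= `[a, b]}.

Lemma le_Eiid n f g : (forall s, sample n s -> f s <= g s) ->
  (Eiid mu n f <= Eiid mu n g)%E.
Proof.
rewrite /Eiid /sample; elim: n f g => [|n IH] f g fg /=.
  by rewrite lee_fin fg.
apply: (le_integral_null (measurable_itv _) muab) => x x_ab; apply: IH => s [sn s_ab].
by apply: fg; split => [|z]; rewrite /= ?sn// inE => /predU1P[->//|]; exact: s_ab.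
Qed.

(* Means are bounded through majorants, since order statistics and optimal costs
   are not shown to be measurable. *)
Definition mean_le n f (B : R) := exists e m,
  [/\ iid_mean mu n e m, forall s, sample n s -> f s <= e s & m <= B].

Lemma iid_mean_le n f m : iid_mean mu n f m -> mean_le n f m.
Proof. by move=> fm; exists f, m. Qed.

Lemma mean_le_mono n f g B B' : (forall s, sample n s -> f s <= g s) -> B <= B' ->
  mean_le n g B -> mean_le n f B'.
Proof.
move=> fg BB' [e [m [em ge mB]]]; exists e, m; split => //.
  by move=> s ss; exact: le_trans (fg s ss) (ge s ss).
exact: le_trans BB'.
Qed.

Lemma mean_leW n f B B' : B <= B' -> mean_le n f B -> mean_le n f B'.
Proof. exact: mean_le_mono. Qed.

Lemma mean_le_cst n (r : R) : mean_le n (fun=> r) r.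
Proof. exact/iid_mean_le/iid_mean_cst. Qed.

Lemma mean_leD n f g B B' : mean_le n f B -> mean_le n g B' ->
  mean_le n (fun s => f s + g s) (B + B').
Proof.
move=> [e [m [em fe mB]]] [e' [m' [em' ge' mB']]].
exists (fun s => e s + e' s), (m + m'); split; first exact: iid_meanD.
  by move=> s ss; rewrite lerD ?fe ?ge'.
exact: lerD.
Qed.

Lemma mean_leZ n (r : R) f B : 0 <= r -> mean_le n f B ->
  mean_le n (fun s => r * f s) (r * B).
Proof.
move=> r0 [e [m [em fe mB]]]; exists (fun s => r * e s), (r * m); split.
- exact: iid_meanZ.
- by move=> s ss; rewrite ler_wpM2l// fe.
- exact: ler_wpM2l.
Qed.

Lemma mean_le_sum (I : eqType) (r : seq I) n (f : I -> seq R -> R) (B : I -> R) :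
  {in r, forall i, mean_le n (f i) (B i)} ->
  mean_le n (fun s => \sum_(i <- r) f i s) (\sum_(i <- r) B i).
Proof.
elim: r => [|i r IH] fB.
  by rewrite big_nil; under eq_fun do rewrite big_nil; exact: mean_le_cst.
rewrite big_cons; under eq_fun do rewrite big_cons.
apply: mean_leD; first by apply: fB; rewrite mem_head.
by apply: IH => j jr; apply: fB; rewrite inE jr orbT.
Qed.

Lemma Eiid_le n f g m B : iid_mean mu n g m -> mean_le n (fun s => f s - g s) B ->
  (Eiid mu n f <= (m + B)%:E)%E.
Proof.
move=> gm [e [p [ep fge pB]]].
apply: (@le_trans _ _ (Eiid mu n (fun s => g s + e s))).
  by apply: le_Eiid => s ss; have := fge s ss; rewrite lerBlDl.
by rewrite (iid_mean_Eiid (iid_meanD gm ep)) lee_fin lerD2l.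
Qed.

Lemma Eiid_ge n f g m B : iid_mean mu n g m -> mean_le n (fun s => g s - f s) B ->
  ((m - B)%:E <= Eiid mu n f)%E.
Proof.
move=> gm [e [p [ep gfe pB]]].
apply: (@le_trans _ _ (Eiid mu n (fun s => g s - e s))).
  by rewrite (iid_mean_Eiid (iid_meanB gm ep)) lee_fin lerB.
by apply: le_Eiid => s ss; have := gfe s ss; rewrite !lerBlDr addrC.
Qed.

Lemma mean_le_sqr_discrepancy n (g : R -> R) (M : R) : (0 < n)%N ->
  measurable_fun setT g -> (forall x, `|g x - \int[mu]_y g y| <= M) ->
  mean_le n (fun s => discrepancy mu g s ^+ 2) (M ^+ 2 / n%:R).
Proof.
move=> n0 mg gM; set m := \int[mu]_y g y.
have nullT : mu (~` setT) = 0%E by rewrite setCT measure0.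
have mcen : measurable_fun setT (fun x => (g x - m) ^+ 2).
  by apply: measurable_funX; exact: measurable_funB.
have cen2 x : setT x -> `|(g x - m) ^+ 2| <= M ^+ 2.
  by rewrite normrX lerXn2r ?nnegrE ?gM//= (le_trans _ (gM x)).
have g_int : mu.-integrable setT (EFin \o g).
  apply: (bounded_integrable_null measurableT nullT mg (M := M + `|m|)) => x _.
  by rewrite -lerBlDr; exact: le_trans (lerB_dist _ _) (gM x).
have cen2_int := bounded_integrable_null measurableT nullT mcen cen2.
apply: mean_leW (iid_mean_le (iid_mean_sqr_discrepancy n0 g_int cen2_int)).
rewrite ler_pM2r ?invr_gt0 ?ltr0n//.
exact: le_trans (ler_norm _) (normr_Rintegral_le_null measurableT nullT mcen cen2).
Qed.

Lemma mean_le_normr n f (h : R) : 0 < h -> mean_le n (fun s => f s ^+ 2) (h ^+ 2) ->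
  mean_le n (fun s => `|f s|) h.
Proof.
move=> h0 fh; have h2 : 0 <= (2 * h)^-1 by rewrite invr_ge0 mulr_ge0// ltW.
apply: mean_le_mono (mean_leD (mean_le_cst n (h / 2)) (mean_leZ h2 fh)).
  by move=> s _; exact: normr_le_half_sqr.
by rewrite le_eqVlt; apply/orP; left; apply/eqP; field; rewrite gt_eqF.
Qed.

Lemma mean_le_sqr_ecdf n t : (0 < n)%N ->
  mean_le n (fun s => (ecdf s t - cdfmu mu t) ^+ 2) n%:R^-1.
Proof.
move=> n0; have m_itv : measurable_fun setT (\1_(`]-oo, t]%classic) : R -> R).
  exact: measurable_indic.
have cdfE : \int[mu]_x \1_(`]-oo, t]%classic) x = cdfmu mu t.
  by rewrite /Rintegral integral_indic// setIT.
apply: (mean_le_mono _ _ (@mean_le_sqr_discrepancy n _ 1 n0 m_itv _)).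
- by move=> s _; rewrite discrepancy_itvNyc.
- by rewrite expr1n mul1r.
move=> x; have /andP[F0 F1] := cdfmu_itv01 mu t.
by rewrite cdfE indicE ler_norml; case: (_ \in _) => /=; apply/andP; split; lra.
Qed.

Lemma mean_le_normr_ecdf n t : (0 < n)%N ->
  mean_le n (fun s => `|ecdf s t - cdfmu mu t|) (Num.sqrt n%:R)^-1.
Proof.
move=> n0; apply: mean_le_normr; first by rewrite invr_gt0 sqrtr_gt0 ltr0n.
by rewrite exprVn sqr_sqrtr ?ler0n//; exact: mean_le_sqr_ecdf.
Qed.

End MeanLe.

Section LipschitzDiscrepancy.
Context (R : realType) (mu : probability R R) (a b : R).
Hypothesis muab : mu (~` `[a, b]) = 0%E.

Lemma normr_discrepancy_le (h : R -> R) (M : R) s : (0 < size s)%N ->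
  {subset s <= `[a, b]} -> measurable_fun setT h ->
  {in `[a, b], forall x, `|h x| <= M} -> `|discrepancy mu h s| <= 2 * M.
Proof.
move=> s0 s_ab mh hM; have h_between x : x \in s -> - M <= h x <= M.
  by move=> /s_ab/hM; rewrite ler_norml.
have lo : - M <= sample_mean h s.
  by rewrite -(sample_mean_cst (- M) s0); apply: le_sample_mean => x /h_between/andP[].
have up : sample_mean h s <= M.
  by rewrite -(sample_mean_cst M s0); apply: le_sample_mean => x /h_between/andP[].
have := normr_Rintegral_le_null (measurable_itv _) muab mh hM.
rewrite ler_norml => /andP[? ?].
by rewrite /discrepancy ler_norml; apply/andP; split; lra.
Qed.

Definition step_fun (r : R) (w t : nat -> R) M (x : R) : R :=
  r + \sum_(i < M) w i * \1_(`]-oo, t i]%classic) x.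

Lemma measurable_step_fun r w t M : measurable_fun setT (step_fun r w t M).
Proof.
apply: measurable_funD => //; apply: measurable_sum => i.
by apply: measurable_funM => //; exact: measurable_indic.
Qed.

Lemma step_funS r w t M : step_fun r w t M.+1 =
  fun x => step_fun r w t M x + w M * \1_(`]-oo, t M]%classic) x.
Proof. by apply/funext => x; rewrite /step_fun big_ord_recr addrA. Qed.

Lemma step_fun0 r w t : step_fun r w t 0 = fun=> r.
Proof. by apply/funext => x; rewrite /step_fun big_ord0 addr0. Qed.

Lemma integrable_step_fun r w t M : mu.-integrable setT (EFin \o step_fun r w t M).
Proof.
elim: M => [|M IH]; first by rewrite step_fun0; exact: finite_measure_integrable_cst.
have last_int := integrableZl measurableT (w M) (integrable_itvNyc mu (t M)).
rewrite step_funS; exact: (integrableD measurableT IH last_int).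
Qed.

Lemma discrepancy_step_fun r w t M s : (0 < size s)%N ->
  discrepancy mu (step_fun r w t M) s =
  \sum_(i < M) w i * (ecdf s (t i) - cdfmu mu (t i)).
Proof.
move=> s0; elim: M => [|M IH]; first by rewrite step_fun0 discrepancy_cst// big_ord0.
rewrite step_funS discrepancyD ?discrepancyZ ?IH ?discrepancy_itvNyc ?big_ord_recr//.
- exact: integrable_itvNyc.
- exact: integrable_step_fun.
- exact: (integrableZl measurableT (w M) (integrable_itvNyc mu (t M))).
Qed.

Definition grid (dl : R) (i : nat) : R := a + i%:R * dl.

Lemma gridS dl i : grid dl i.+1 = grid dl i + dl.
Proof. by rewrite /grid -natr1; ring. Qed.

Variable g : R -> R.
Hypotheses (mg : measurable_fun setT g) (g_lip : forall x y, `|g x - g y| <= `|x - y|).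

(* Abel summation: [g] is a combination of the indicators of the half-lines
   ending at the grid points, up to the mesh of the grid. *)
Definition grid_step (dl : R) (M : nat) : R -> R :=
  step_fun (g (grid dl M)) (fun i => g (grid dl i) - g (grid dl i.+1)) (grid dl) M.

Lemma grid_step_approx dl M x : 0 <= dl -> a <= x <= grid dl M ->
  `|g x - grid_step dl M x| <= dl.
Proof.
move=> dl0 /andP[ax]; elim: M => [|M IH] xM.
  have -> : x = grid dl 0 by apply/eqP; rewrite eq_le xM /grid mul0r addr0.
  by rewrite /grid_step step_fun0 subrr normr0.
rewrite /grid_step step_funS /step_fun.
have indic_itv i : \1_(`]-oo, grid dl i]%classic) x = (x <= grid dl i)%R%:R :> R.
  by rewrite indicE mem_setE in_itv.
have [le_xM|lt_Mx] := leP x (grid dl M).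
  have := IH le_xM; congr (`|_ - _| <= _).
  by rewrite /grid_step /step_fun indic_itv le_xM mulr1; ring.
rewrite big1 => [|i _]; last first.
  rewrite indic_itv lt_geF ?mulr0// (le_lt_trans _ lt_Mx)//.
  by rewrite lerD2l ler_wpM2r// ler_nat ltnW.
rewrite indic_itv (lt_geF lt_Mx) mulr0 !addr0; apply: (le_trans (g_lip _ _)).
by rewrite ler0_norm gridS; move: xM; rewrite gridS; lra.
Qed.

Lemma lipschitz_discrepancy_le dl M s : 0 <= dl -> b <= grid dl M -> (0 < size s)%N ->
  {subset s <= `[a, b]} ->
  `|discrepancy mu g s| <=
    2 * dl + dl * \sum_(i < M) `|ecdf s (grid dl i) - cdfmu mu (grid dl i)|.
Proof.
move=> dl0 bM s0 s_ab; pose rest x := g x - grid_step dl M x.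
have mstep : measurable_fun setT (grid_step dl M) by exact: measurable_step_fun.
have mrest : measurable_fun setT rest by exact: measurable_funB.
have rest_le : {in `[a, b], forall x, `|rest x| <= dl}.
  move=> x; rewrite in_itv/= => /andP[ax xb]; apply: grid_step_approx => //.
  by rewrite ax (le_trans xb).
have rest_int := bounded_integrable_null (measurable_itv _) muab mrest rest_le.
have -> : g = fun x => grid_step dl M x + rest x.
  by apply/funext => x; rewrite /rest addrC subrK.
rewrite discrepancyD//; last exact: integrable_step_fun.
rewrite discrepancy_step_fun// addrC; apply: (le_trans (ler_normD _ _)).
apply: lerD; first exact: normr_discrepancy_le.
apply: (le_trans (ler_norm_sum _ _ _)); rewrite mulr_sumr; apply: ler_sum => i _.
rewrite normrM ler_wpM2r//; apply: (le_trans (g_lip _ _)).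
by rewrite distrC gridS addrC addKr ger0_norm.
Qed.

End LipschitzDiscrepancy.

Section UniformDiscrepancy.
Context (R : realType) (mu : probability R R) (a b : R).
Hypotheses (ab : a <= b) (muab : mu (~` `[a, b]) = 0%E).

Lemma mean_le_lipschitz_discrepancy n : (0 < n)%N -> exists e : seq R -> R,
  mean_le mu a b n e (3 * (b - a) / Num.sqrt n%:R) /\
  forall g : R -> R, measurable_fun setT g -> (forall x y, `|g x - g y| <= `|x - y|) ->
    forall s, sample a b n s -> `|discrepancy mu g s| <= e s.
Proof.
move=> n0; set dl := (b - a) / n%:R; set T := grid a dl.
have n_gt0 : 0 < n%:R :> R by rewrite ltr0n.
have dl0 : 0 <= dl by rewrite divr_ge0 ?subr_ge0.
have Tn : T n = b by rewrite /T /grid /dl; field; rewrite gt_eqF.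
exists (fun s => 2 * dl + dl * \sum_(i < n) `|ecdf s (T i) - cdfmu mu (T i)|).
split=> [|g mg g_lip s [sn s_ab]]; last first.
  by apply: (lipschitz_discrepancy_le muab mg g_lip); rewrite ?sn -/T ?Tn.
have deviations : mean_le mu a b n
    (fun s => \sum_(i < n) `|ecdf s (T i) - cdfmu mu (T i)|)
    (\sum_(i < n) (Num.sqrt n%:R)^-1).
  by apply: mean_le_sum => i _; exact: mean_le_normr_ecdf.
apply: mean_leW (mean_leD (mean_le_cst _ _ _ _ (2 * dl)) (mean_leZ dl0 deviations)).
rewrite big_const_ord iter_addr_0 -[_ *+ n]mulr_natl.
have -> : dl * (n%:R / Num.sqrt n%:R) = (b - a) / Num.sqrt n%:R.
  by rewrite mulrA divfK ?gt_eqF.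
have : dl <= (b - a) / Num.sqrt n%:R.
  rewrite ler_wpM2l ?subr_ge0// lef_pV2 ?posrE ?sqrtr_gt0//.
  rewrite -{2}[n%:R](sqr_sqrtr (ltW n_gt0)) expr2 ler_peMr ?sqrtr_ge0//.
  by rewrite -{1}sqrtr1 ler_wsqrtr// ler1n.
by lra.
Qed.

End UniformDiscrepancy.

(** * Order statistics *)

Section OrderStatistic.
Context (R : realType).
Implicit Types (v t : R) (s : seq R).

Definition ostat_rank n v : nat := `|Num.floor ((n%:R - 1) * v)|%N.

Definition ostat v s : R := nth 0 (sort <=%R s) (ostat_rank (size s) v).

Lemma ostat_rankP n v (r := ostat_rank n v) : (0 < n)%N -> 0 <= v <= 1 ->
  [/\ (r < n)%N, r%:R <= (n%:R - 1) * v & (n%:R - 1) * v < r.+1%:R].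
Proof.
move=> n0 /andP[v0 v1].
have n1 : 0 <= n%:R - 1 :> R by rewrite subr_ge0 ler1n.
have rE : r%:R = (Num.floor ((n%:R - 1) * v))%:~R :> R.
  by rewrite /r /ostat_rank natr_absz ger0_norm// floor_ge0 mulr_ge0.
have r_le : r%:R <= (n%:R - 1) * v by rewrite rE floor_le.
split => //; last by rewrite -natr1 rE -intrD1 floorD1_gt.
rewrite -(ltr_nat R); apply: (le_lt_trans r_le).
by apply: (@le_lt_trans _ _ (n%:R - 1)); [rewrite ler_piMr|rewrite ltrBlDr ltrDl].
Qed.

Lemma ostat_mem v s : (0 < size s)%N -> 0 <= v <= 1 -> ostat v s \in s.
Proof.
move=> s0 v01; have [r_lt _ _] := ostat_rankP s0 v01.
by rewrite /ostat -(mem_sort <=%R) mem_nth// size_sort.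
Qed.

Lemma ostat0_le s x : x \in s -> ostat 0 s <= x.
Proof.
rewrite /ostat /ostat_rank mulr0 floor0 -(mem_sort <=%R) => /(nthP 0)[i i_lt <-].
apply: (sorted_leq_nth le_trans lexx 0 (sort_le_sorted s)) => //.
exact: leq_ltn_trans i_lt.
Qed.

Lemma ostat1_ge s x : x \in s -> x <= ostat 1 s.
Proof.
rewrite -(mem_sort <=%R) => /(nthP 0)[i i_lt <-].
have s0 : (0 < size s)%N by rewrite -(size_sort <=%R); exact: leq_ltn_trans i_lt.
have -> : ostat 1 s = nth 0 (sort <=%R s) (size s).-1.
  rewrite /ostat /ostat_rank mulr1 -[X in X%:R](prednK s0) -natr1 addrK.
  by rewrite pmulrn intrKfloor.
rewrite size_sort in i_lt; apply: (sorted_leq_nth le_trans lexx 0 (sort_le_sorted s)).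
- by rewrite inE size_sort.
- by rewrite inE size_sort prednK.
- by rewrite -ltnS prednK.
Qed.

Lemma ecdf_lt_ostat v s t : (0 < size s)%N -> 0 <= v <= 1 ->
  t < ostat v s -> ecdf s t <= v.
Proof.
move=> s0 v01 tX; have [_ r_le _] := ostat_rankP s0 v01.
have count_le : (count (fun x => (x <= t)%R) s <= ostat_rank (size s) v)%N.
  rewrite leqNgt -(count_sort <=%R); apply/negP => r_lt.
  by have := nth_count_le 0 (sort_le_sorted s) r_lt; rewrite leNgt -/(ostat v s) tX.
rewrite /ecdf ler_pdivrMr ?ltr0n//; rewrite -(ler_nat R) in count_le.
have /andP[v0 _] := v01.
by apply: (le_trans count_le); apply: (le_trans r_le); rewrite mulrC ler_wpM2l// gerBl.
Qed.

Lemma ecdf_ge_ostat v s t : (0 < size s)%N -> 0 <= v <= 1 ->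
  ostat v s <= t -> v - (size s)%:R^-1 <= ecdf s t.
Proof.
move=> s0 v01 Xt; have [r_lt _ r_gt] := ostat_rankP s0 v01.
have count_gt : (ostat_rank (size s) v < count (fun x => (x <= t)%R) s)%N.
  rewrite ltnNge -(count_sort <=%R); apply/negP => count_le.
  have := @nth_count_gt _ _ t 0 _ (ostat_rank (size s) v) (sort_le_sorted s).
  by rewrite size_sort count_le r_lt => /(_ isT); rewrite ltNge -/(ostat v s) Xt.
have size_gt0 : 0 < (size s)%:R :> R by rewrite ltr0n.
rewrite -(ler_nat R) in count_gt; rewrite /ecdf ler_pdivlMr//.
apply: le_trans count_gt; apply: le_trans (ltW r_gt).
rewrite mulrBl mulVf ?gt_eqF// mulrBl mul1r mulrC lerD2l lerN2.
by case/andP: v01.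
Qed.

End OrderStatistic.

Section OrderStatisticMean.
Context (R : realType) (mu : probability R R) (a b : R).
Hypothesis reg : regular_law mu a b.
Local Notation F := (cdfmu mu).
Local Notation sample := (sample a b).
Local Notation mean_le := (mean_le mu a b).

Lemma ostat_between_ecdf q s t : (0 < size s)%N ->
  Num.min q (ostat (F q) s) < t < Num.max q (ostat (F q) s) ->
  `|F t - F q| <= `|ecdf s t - F t| + (size s)%:R^-1.
Proof.
move=> s0; rewrite gt_min lt_max => /andP[lt_t t_lt].
have size_inv : 0 <= (size s)%:R^-1 :> R by rewrite invr_ge0.
have [qt|tq] := leP q t.
  have tX : t < ostat (F q) s by move: t_lt; rewrite ltNge qt.
  have := ecdf_lt_ostat s0 (cdfmu_itv01 mu q) tX.
  rewrite ger0_norm ?subr_ge0 ?cdfmu_le// distrC => ecdf_le.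
  by have := ler_norm (F t - ecdf s t); lra.
have Xt : ostat (F q) s <= t by move: lt_t; rewrite ltNge (ltW tq)/= => /ltW.
have := ecdf_ge_ostat s0 (cdfmu_itv01 mu q) Xt.
rewrite distrC ger0_norm ?subr_ge0 ?cdfmu_le ?(ltW tq)// => ecdf_ge.
by have := ler_norm (ecdf s t - F t); lra.
Qed.

(* Chebyshev: the order statistic is [r] away from the quantile [q] only if the
   empirical c.d.f. deviates by [g] at one of the points [q - r], [q + r]. *)
Lemma mean_le_ostat_tail n q r g : (0 < n)%N -> 0 < g ->
  (forall t, t \in `[a, b] -> `|t - q| = r -> g + n%:R^-1 <= `|F t - F q|) ->
  q \in `[a, b] -> 0 < r ->
  mean_le n (fun s => (r < `|ostat (F q) s - q|)%R%:R) (2 / (g ^+ 2 * n%:R)).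
Proof.
move=> n0 g0 g_le q_ab r0; pose dev t s := (ecdf s t - F t) ^+ 2.
have g2 : 0 <= (g ^+ 2)^-1 by rewrite invr_ge0 sqr_ge0.
have devs := mean_leZ g2
  (mean_leD (mean_le_sqr_ecdf mu a b (q - r) n0) (mean_le_sqr_ecdf mu a b (q + r) n0)).
apply: mean_le_mono devs; last first.
  rewrite le_eqVlt; apply/orP; left; apply/eqP; field.
  by rewrite !lt0r_neq0// ltr0n.
move=> s [sn s_ab]; have s0 : (0 < size s)%N by rewrite sn.
have dev_ge t : t \in `[a, b] -> `|t - q| = r ->
    Num.min q (ostat (F q) s) < t < Num.max q (ostat (F q) s) -> g ^+ 2 <= dev t s.
  move=> t_ab tq /(ostat_between_ecdf s0); rewrite sn => F_le.
  rewrite /dev -[leRHS]real_normK ?num_real// lerXn2r ?nnegrE ?(ltW g0)//.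
  by have := g_le t t_ab tq; lra.
have X_ab := s_ab _ (ostat_mem s0 (cdfmu_itv01 mu q)).
move: X_ab q_ab dev_ge; set X := ostat _ _; rewrite !in_itv/=.
move=> /andP[aX Xb] /andP[aq qb] dev_ge.
have [far|_] := ltP r `|X - q|; last by rewrite mulr_ge0// addr_ge0// sqr_ge0.
rewrite mulrC ler_pdivlMr ?exprn_gt0// mul1r; move: far; have [Xq|qX] := leP X q.
  rewrite ler0_norm ?subr_le0// opprB => far.
  apply: (@le_trans _ _ (dev (q - r) s)); last by rewrite lerDl sqr_ge0.
  apply: dev_ge; first by rewrite in_itv/=; apply/andP; split; lra.
    by rewrite addrAC subrr add0r normrN gtr0_norm.
  by rewrite gt_min lt_max; apply/andP; split; apply/orP; [right|left]; lra.
rewrite gtr0_norm ?subr_gt0// => far.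
apply: (@le_trans _ _ (dev (q + r) s)); last by rewrite lerDr sqr_ge0.
apply: dev_ge; first by rewrite in_itv/=; apply/andP; split; lra.
  by rewrite addrAC subrr add0r gtr0_norm.
by rewrite gt_min lt_max; apply/andP; split; apply/orP; [left|right]; lra.
Qed.

Lemma sample_ostat_dist n q s : (0 < n)%N -> sample n s -> q \in `[a, b] ->
  `|ostat (F q) s - q| <= b - a.
Proof.
move=> n0 [sn s_ab]; have := s_ab _ (ostat_mem (_ : (0 < size s)%N) (cdfmu_itv01 mu q)).
rewrite sn !in_itv/= => /(_ n0) /andP[? ?] /andP[? ?].
by rewrite ler_distl; apply/andP; split; lra.
Qed.

Lemma mean_le_ostat_consistent q e : q \in `[a, b] -> 0 < e ->
  \forall n \near \oo, mean_le n (fun s => `|ostat (F q) s - q|) e.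
Proof.
move=> q_ab e0; have r0 : 0 < e / 2 by rewrite divr_gt0.
have [g g0 g_le] := cdfmu_separated (regular_cdf_lt reg) q_ab r0.
have h0 : 0 < g / 2 by rewrite divr_gt0.
have ba0 : 0 < b - a by rewrite subr_gt0 (regular_lt reg).
near=> n; have n0 : (0 < n)%N by near: n; exact: nbhs_infty_gt.
have n_g : n%:R^-1 <= g / 2 by near: n; exact: near_invn_le.
have n_e : n%:R^-1 <= e / 2 / ((b - a) * (2 / (g / 2) ^+ 2)).
  by near: n; apply: near_invn_le; rewrite divr_gt0// mulr_gt0// divr_gt0// exprn_gt0.
have tail : mean_le n (fun s => (e / 2 < `|ostat (F q) s - q|)%R%:R)
    (2 / ((g / 2) ^+ 2 * n%:R)).
  apply: mean_le_ostat_tail => // t t_ab tq.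
  by have := g_le t t_ab; rewrite tq => /(_ (lexx _)); lra.
apply: mean_le_mono (mean_leD (mean_le_cst _ _ _ _ (e / 2)) (mean_leZ (ltW ba0) tail)).
  move=> s ss; have X_le := sample_ostat_dist n0 ss q_ab.
  by case: ltP => /= [_|?]; rewrite ?mulr1 ?mulr0; lra.
move: n_e; rewrite ler_pdivlMr; last by rewrite mulr_gt0// divr_gt0// exprn_gt0.
suff -> : (b - a) * (2 / ((g / 2) ^+ 2 * n%:R)) =
    n%:R^-1 * ((b - a) * (2 / (g / 2) ^+ 2)) by lra.
by field; rewrite !lt0r_neq0// ltr0n.
Unshelve. all: by end_near. Qed.

(* Splitting [|X - q|] into layers of width [h = 1 / sqrt n], the [i]-th layer is
   reached with probability [O(1 / i^2)], since the c.d.f. has increased by at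
   least [m * i * h] there. *)
Lemma mean_le_ostat_rate q : q \in `]a, b[ ->
  exists2 C, 0 <= C & \forall n \near \oo,
    mean_le n (fun s => `|ostat (F q) s - q|) (C / Num.sqrt n%:R).
Proof.
move=> q_oo; have q_ab := subset_itv_oo_cc q_oo.
have [m m0 slope] := regular_slope reg q_oo.
exists (1 + 16 / m ^+ 2); first by rewrite addr_ge0// divr_ge0 ?sqr_ge0.
near=> n; have n0 : (0 < n)%N by near: n; exact: nbhs_infty_gt.
set h := (Num.sqrt n%:R)^-1.
have h0 : 0 < h by rewrite invr_gt0 sqrtr_gt0 ltr0n.
have n_h : n%:R^-1 = h ^+ 2 by rewrite exprVn sqr_sqrtr ?ler0n.
have h_m : h <= m / 2.
  rewrite -(@ler_pXn2r _ 2)// ?nnegrE ?divr_ge0 ?(ltW m0) ?(ltW h0)// -n_h.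
  by near: n; apply: near_invn_le; rewrite exprn_gt0// divr_gt0.
have tail i : mean_le n (fun s => (i.+1%:R * h < `|ostat (F q) s - q|)%R%:R)
    (8 / m ^+ 2 * (i.+1%:R ^+ 2)^-1).
  have r0 : 0 < i.+1%:R * h by rewrite mulr_gt0// ltr0n.
  have g0 : 0 < m / 2 * (i.+1%:R * h) by rewrite mulr_gt0// divr_gt0.
  have i1 : h <= i.+1%:R * h by rewrite ler_peMl ?ler1n// ltW.
  apply: mean_leW (mean_le_ostat_tail n0 g0 _ q_ab r0) => [|t t_ab tq].
    rewrite -[X in _ / (_ * X)]invrK n_h le_eqVlt; apply/orP; left; apply/eqP.
    by field; rewrite !lt0r_neq0// ltr0n.
  have := slope t t_ab; rewrite tq => /(le_trans _); apply; rewrite n_h expr2.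
  have : h * h <= m / 2 * (i.+1%:R * h) by apply: ler_pM => //; exact: ltW.
  by lra.
pose M := Num.truncn ((b - a) / h).
have M_ge : b - a <= h * M.+1%:R.
  by rewrite mulrC -ler_pdivrMr// ltW// truncnS_gt.
apply: mean_le_mono (mean_leD (mean_le_cst mu a b n h)
  (mean_le_sum (r := index_enum 'I_M) (fun i _ => mean_leZ (ltW h0) (tail i)))).
  move=> s ss; apply: le_layer_sum; first exact: ltW.
  exact: le_trans (sample_ostat_dist n0 ss q_ab) M_ge.
rewrite -!mulr_sumr [leRHS]mulrDl mul1r lerD2l.
have -> : 16 / m ^+ 2 * h = h * (8 / m ^+ 2 * 2) by field; rewrite gt_eqF.
by rewrite ler_wpM2l ?(ltW h0)// ler_wpM2l ?sum_inv_sqr_le2// divr_ge0 ?sqr_ge0.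
Unshelve. all: by end_near. Qed.

End OrderStatisticMean.

(** * Percentile mechanisms *)

Section PercentileLoss.
Context (R : realType) (mu : probability R R) (a b : R).
Hypothesis reg : regular_law mu a b.
Local Notation F := (cdfmu mu).
Local Notation mean_le := (mean_le mu a b).
Implicit Types (s ys qs : seq R).

Definition ostat_loss q s : R :=
  \big[Num.max/0]_(x <- s) (`|x - ostat (F q) s| - `|x - q|).

Lemma ostat_loss_ge0 q s : 0 <= ostat_loss q s.
Proof. exact: bigmax_ge_id. Qed.

Lemma le_ostat_loss q s x : x \in s -> `|x - ostat (F q) s| <= `|x - q| + ostat_loss q s.
Proof.
move=> xs; rewrite -lerBlDl.
exact: (le_bigmax_seq _ x xpredT (fun z => `|z - _| - `|z - q|) xs isT).
Qed.

Lemma ostat_loss_le q s (e : R) : 0 <= e ->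
  {in s, forall x, `|x - ostat (F q) s| <= `|x - q| + e} -> ostat_loss q s <= e.
Proof.
move=> e0 le_e; rewrite /ostat_loss big_seq; apply: bigmax_le => // x /le_e.
by rewrite lerBlDl.
Qed.

(* At an endpoint of the support, where the density may vanish, the percentile is
   an extreme order statistic, which lies between every report and [q]. *)
Lemma ostat_loss_endpoint q s : (0 < size s)%N -> {subset s <= `[a, b]} ->
  q = a \/ q = b -> ostat_loss q s <= 0.
Proof.
move=> s0 s_ab q_end; apply: ostat_loss_le => // x xs; rewrite addr0.
have := s_ab _ (ostat_mem s0 (cdfmu_itv01 mu q)); rewrite in_itv/= => /andP[].
case: q_end => ->; rewrite (regular_cdf0 reg, regular_cdf1 reg) => aX Xb.
  by have ? := ostat0_le xs; rewrite !ger0_norm ?subr_ge0//; lra.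
by have ? := ostat1_ge xs; rewrite !ler0_norm ?subr_le0//; lra.
Qed.

Lemma mean_le_ostat_loss_rate q : q \in `[a, b] ->
  exists2 C, 0 <= C & \forall n \near \oo, mean_le n (ostat_loss q) (C / Num.sqrt n%:R).
Proof.
move=> q_ab; have [q_oo|q_end] := boolP (q \in `]a, b[).
  have [C C0 rate] := mean_le_ostat_rate reg q_oo; exists C => //; near=> n.
  have rate_n : mean_le n (fun s => `|ostat (F q) s - q|) (C / Num.sqrt n%:R) by near: n.
  apply: mean_le_mono rate_n => // s _; apply: ostat_loss_le => // x _.
  by apply: le_trans (ler_distD q _ _) _; rewrite [`|q - _|]distrC.
have {}q_end : q = a \/ q = b.
  move: q_ab q_end; rewrite !in_itv/= negb_and -!leNgt => /andP[aq qb] /orP[qa|bq].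
    by left; apply/eqP; rewrite eq_le qa.
  by right; apply/eqP; rewrite eq_le qb.
exists 0 => //; near=> n; rewrite mul0r.
have n0 : (0 < n)%N by near: n; exact: nbhs_infty_gt.
apply: mean_le_mono (mean_le_cst mu a b n 0) => // s [sn s_ab].
by apply: ostat_loss_endpoint; rewrite ?sn.
Unshelve. all: by end_near. Qed.

Lemma PM_map_cdf qs s : PM (map F qs) s = [seq ostat (F q) s | q <- qs].
Proof. by rewrite /PM -map_comp. Qed.

Lemma SC_le s ys zs (e : R) : (0 < size s)%N ->
  {in s, forall x, dist_to x ys <= dist_to x zs + e} -> SC s ys <= SC s zs + e.
Proof.
move=> s0 le_e; rewrite -[e in leRHS](sample_mean_cst e s0).
by rewrite -[leRHS]sample_meanD; exact: le_sample_mean.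
Qed.

Lemma SCv_le_loss qs s : (0 < size s)%N ->
  SCv (map F qs) s <= SC s qs + \sum_(q <- qs) ostat_loss q s.
Proof.
move=> s0; rewrite /SCv PM_map_cdf; apply: SC_le => // x xs.
rewrite -[in dist_to x qs](map_id qs); apply: le_dist_to_map.
  by apply: sumr_ge0 => q _; exact: ostat_loss_ge0.
move=> q qqs; apply: le_trans (le_ostat_loss q xs) _; rewrite lerD2l.
by rewrite (big_rem q)//= lerDl sumr_ge0// => z _; exact: ostat_loss_ge0.
Qed.

Lemma SCv_dist_le qs s : (0 < size s)%N ->
  `|SCv (map F qs) s - SC s qs| <= \sum_(q <- qs) `|ostat (F q) s - q|.
Proof.
move=> s0; rewrite /SCv PM_map_cdf.
have le_sum q : q \in qs -> `|ostat (F q) s - q| <= \sum_(q <- qs) `|ostat (F q) s - q|.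
  by move=> qqs; rewrite (big_rem q)//= lerDl sumr_ge0.
have sum_ge0 : 0 <= \sum_(q <- qs) `|ostat (F q) s - q| by exact: sumr_ge0.
rewrite ler_distl lerBlDr; apply/andP; split; apply: SC_le => // x _;
  rewrite -[in dist_to x qs](map_id qs); apply: le_dist_to_map => // q /le_sum q_le.
- by apply: (le_trans (ler_distD (ostat (F q) s) _ _)); rewrite lerD2l.
- by apply: (le_trans (ler_distD q _ _)); rewrite lerD2l distrC.
Qed.

Lemma mean_le_SCv_rate qs : {subset qs <= `[a, b]} ->
  exists2 C, 0 <= C & \forall n \near \oo,
    mean_le n (fun s => SCv (map F qs) s - SC s qs) (C / Num.sqrt n%:R).
Proof.
move=> qs_ab; have /choice[C CP] : forall q, exists C, 0 <= C /\ (q \in qs ->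
    \forall n \near \oo, mean_le n (ostat_loss q) (C / Num.sqrt n%:R)).
  move=> q; have [/qs_ab/mean_le_ostat_loss_rate[C C0 rate]|] := boolP (q \in qs).
    by exists C.
  by exists 0.
have rates : \forall n \near \oo,
    {in qs, forall q, mean_le n (ostat_loss q) (C q / Num.sqrt n%:R)}.
  by apply: filter_in_seq => q qqs; exact: (CP q).2.
exists (\sum_(q <- qs) C q); first by apply: sumr_ge0 => q _; exact: (CP q).1.
apply: filterS2 (nbhs_infty_gt 0) rates => n n0 rate_n.
rewrite mulr_suml; apply: mean_le_mono (mean_le_sum rate_n) => // s [sn _].
by rewrite lerBlDl SCv_le_loss// sn.
Qed.

Lemma mean_le_SCv_consistent qs e : {subset qs <= `[a, b]} -> 0 < e ->
  \forall n \near \oo, mean_le n (fun s => `|SCv (map F qs) s - SC s qs|) e.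
Proof.
move=> qs_ab e0; have e_size : 0 < e / (size qs).+1%:R by rewrite divr_gt0// ltr0n.
have consistent : \forall n \near \oo, {in qs, forall q,
    mean_le n (fun s => `|ostat (F q) s - q|) (e / (size qs).+1%:R)}.
  by apply: filter_in_seq => q /qs_ab q_ab; exact: mean_le_ostat_consistent.
apply: filterS2 (nbhs_infty_gt 0) consistent => n n0 consistent_n.
apply: mean_le_mono (mean_le_sum consistent_n).
  by move=> s [sn _]; rewrite SCv_dist_le// sn.
rewrite big_const_seq count_predT iter_addr_0 -[_ *+ _]mulr_natr mulrAC.
by rewrite ler_pdivrMr ?ltr0n// ler_wpM2l ?ler_nat// ltW.
Qed.

End PercentileLoss.

Section ExpectedCost.
Context (R : realType) (mu : probability R R) (a b : R).
Hypothesis reg : regular_law mu a b.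
Local Notation F := (cdfmu mu).
Local Notation mean_le := (mean_le mu a b).
Implicit Types (s ys qs : seq R).

Let muab : mu (~` `[a, b]) = 0%E. Proof. exact: regular_null reg. Qed.

Lemma SC_ge0 s ys : 0 <= SC s ys.
Proof. by rewrite mulr_ge0 ?invr_ge0// sumr_ge0// => x _; exact: dist_to_ge0. Qed.

Lemma Eiid_SCv_ge0 n (v : seq R) : (0 <= Eiid mu n (SCv v))%E.
Proof.
apply: (@le_trans _ _ (Eiid mu n (fun=> 0))).
  by rewrite (iid_mean_Eiid (iid_mean_cst mu n 0)).
by apply: (le_Eiid muab) => s _; exact: SC_ge0.
Qed.

Lemma SCopt_le k s ys : size ys = k -> SCopt k s <= SC s ys.
Proof.
move=> ysk; apply: ge_inf; last by exists ys.
by exists 0 => _ [z _ <-]; exact: SC_ge0.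
Qed.

Lemma SCopt_ge k s (z : R) : (forall ys, size ys = k -> z <= SC s ys) -> z <= SCopt k s.
Proof.
move=> z_le; apply: lb_le_inf; last by move=> _ [ys ysk <-]; exact: z_le.
by exists (SC s (nseq k 0)); exists (nseq k 0) => //=; rewrite size_nseq.
Qed.

Lemma iid_mean_SC n ys : (0 < n)%N ->
  iid_mean mu n (fun s => SC s ys) (fine (qcost mu ys)).
Proof. by move=> n0; exact: iid_mean_sample_mean n0 (integrable_dist_to ys muab). Qed.

Lemma Eiid_SCv_rate qs : {subset qs <= `[a, b]} -> exists2 C, 0 <= C &
  \forall n \near \oo,
    (Eiid mu n (SCv (map F qs)) <= (fine (qcost mu qs) + C / Num.sqrt n%:R)%:E)%E.
Proof.
move=> /(mean_le_SCv_rate reg)[C C0 rate]; exists C => //; near=> n.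
have n0 : (0 < n)%N by near: n; exact: nbhs_infty_gt.
by apply: (Eiid_le muab (iid_mean_SC qs n0)); near: n.
Unshelve. all: by end_near. Qed.

Lemma Eiid_SCv_cvg qs : {subset qs <= `[a, b]} ->
  fine (Eiid mu n (SCv (map F qs))) @[n --> \oo] --> fine (qcost mu qs).
Proof.
move=> qs_ab; apply/cvgrPdist_le => e e0; near=> n.
have n0 : (0 < n)%N by near: n; exact: nbhs_infty_gt.
have SCv_near : mean_le n (fun s => `|SCv (map F qs) s - SC s qs|) e.
  by near: n; exact: mean_le_SCv_consistent.
rewrite distrC ler_distl; apply: (fine_between _).2; apply/andP; split.
  apply: (Eiid_ge muab (iid_mean_SC qs n0)); apply: mean_le_mono SCv_near => // s _.
  by rewrite -normrN opprB ler_norm.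
apply: (Eiid_le muab (iid_mean_SC qs n0)); apply: mean_le_mono SCv_near => // s _.
exact: ler_norm.
Unshelve. all: by end_near. Qed.

(* The discrepancy bound is uniform over the facilities, hence applies to the
   sample-dependent optimal ones. *)
Lemma Eiid_SCopt_itv k ys n : optimal_points mu k ys -> (0 < n)%N ->
  ((fine (qcost mu ys) - 3 * (b - a) / Num.sqrt n%:R)%:E <= Eiid mu n (SCopt k) <=
     (fine (qcost mu ys))%:E)%E.
Proof.
move=> [ysk ys_opt] n0; apply/andP; split; last first.
  rewrite -(iid_mean_Eiid (iid_mean_SC ys n0)); apply: (le_Eiid muab) => s _.
  exact: SCopt_le.
have [e [e_le disc_le]] := mean_le_lipschitz_discrepancy (ltW (regular_lt reg)) muab n0.
apply: (Eiid_ge muab (iid_mean_cst mu n _)); apply: mean_le_mono e_le => // s ss.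
rewrite lerBlDr -lerBlDl; apply: SCopt_ge => zs zsk; rewrite lerBlDr -lerBlDl.
apply: le_trans (disc_le _ (measurable_dist_to zs) (dist_to_lipschitz zs) s ss).
rewrite -normrN opprB; apply: le_trans (ler_norm _); rewrite lerB//.
by apply: fine_le; rewrite ?(qcost_fin_num _ muab) ?ys_opt.
Qed.

End ExpectedCost.

Section ApproximationRatio.
Context (R : realType) (mu : probability R R) (a b : R) (k : nat) (ys : seq R).
Hypothesis reg : regular_law mu a b.
Hypothesis ys_opt : optimal_points mu k ys.
Hypothesis W_gt0 : 0 < fine (qcost mu ys).
Local Notation F := (cdfmu mu).
Local Notation W := (fine (qcost mu ys)).
Implicit Types (qs : seq R).

Let opt n := fine (Eiid mu n (SCopt k)).

Let opt_between n : (0 < n)%N -> Eiid mu n (SCopt k) \is a fin_num /\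
  W - 3 * (b - a) / Num.sqrt n%:R <= opt n <= W.
Proof. by move=> n0; apply: fine_between; exact: (Eiid_SCopt_itv reg). Qed.

Let opt_cvg : opt n @[n --> \oo] --> W.
Proof.
apply: (@squeeze_cvgr _ _ _ _ (fun n => W - 3 * (b - a) / Num.sqrt n%:R) (fun=> W)).
- near=> n; have [|_ //] := @opt_between n; near: n; exact: nbhs_infty_gt.
- rewrite -[X in _ --> X]subr0; apply: cvgB; [exact: cvg_cst|exact: cvg_div_sqrt0].
- exact: cvg_cst.
Unshelve. all: by end_near. Qed.

Lemma Bar_cvg qs : {subset qs <= `[a, b]} ->
  Bar mu k n (map F qs) @[n --> \oo] --> fine (qcost mu qs) / W.
Proof.
move=> qs_ab; apply: cvgM; first exact: (Eiid_SCv_cvg reg).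
by apply: cvgV; rewrite ?gt_eqF.
Qed.

Lemma Bar_dist1_lim qs (B : R) : size qs = k -> {subset qs <= `[a, b]} ->
  fine (qcost mu qs) <= W + B ->
  cvgn (fun n => `|Bar mu k n (map F qs) - 1|) /\
  limn (fun n => `|Bar mu k n (map F qs) - 1|) <= B / W.
Proof.
move=> qsk qs_ab cost_le.
have dist1_cvg : `|Bar mu k n (map F qs) - 1| @[n --> \oo] --> fine (qcost mu qs) / W - 1.
  rewrite -[X in _ --> X]ger0_norm.
    by apply: cvg_norm; apply: cvgB; [exact: Bar_cvg|exact: cvg_cst].
  rewrite subr_ge0 ler_pdivlMr// mul1r.
  by apply: fine_le; rewrite ?(qcost_fin_num _ (regular_null reg)) ?ys_opt.2.
split; first exact: cvgP dist1_cvg.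
rewrite (cvg_lim _ dist1_cvg)// lerBlDl ler_pdivrMr//.
by rewrite mulrDl mul1r divfK ?gt_eqF.
Qed.

Lemma Bar_ge1 qs : size qs = k -> {subset qs <= `[a, b]} ->
  \forall n \near \oo, 1 <= Bar mu k n (map F qs).
Proof.
move=> qsk qs_ab; have [C _ rate] := Eiid_SCv_rate reg qs_ab; near=> n.
have n0 : (0 < n)%N by near: n; exact: nbhs_infty_gt.
have opt_gt0 : 0 < opt n by near: n; exact: (cvgr_gt _ opt_cvg).
have [opt_fin _] := opt_between n0.
have opt_le_SCv : (Eiid mu n (SCopt k) <= Eiid mu n (SCv (map F qs)))%E.
  by apply: (le_Eiid (regular_null reg)) => s _; apply: SCopt_le; rewrite !size_map.
rewrite ler_pdivlMr// mul1r; apply: fine_le => //.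
rewrite ge0_fin_numE ?(Eiid_SCv_ge0 reg)//.
apply: (@le_lt_trans _ _ (fine (qcost mu qs) + C / Num.sqrt n%:R)%:E); last exact: ltry.
by near: n.
Unshelve. all: by end_near. Qed.

Lemma Bar_le_rate qs : {subset qs <= `[a, b]} -> exists2 C, 0 <= C &
  \forall n \near \oo,
    Bar mu k n (map F qs) <= fine (qcost mu qs) / W + C / Num.sqrt n%:R.
Proof.
move=> qs_ab; have [C1 C10 rate] := Eiid_SCv_rate reg qs_ab.
have D0 : 0 <= fine (qcost mu qs) by rewrite fine_ge0// qcost_ge0.
pose C0 := 3 * (b - a).
have C00 : 0 <= C0 by rewrite mulr_ge0// subr_ge0 ltW// (regular_lt reg).
exists (2 * (fine (qcost mu qs) * C0 / W + C1) / W).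
  by have ? := ltW W_gt0; rewrite divr_ge0// mulr_ge0// addr_ge0// divr_ge0// mulr_ge0.
near=> n; have n0 : (0 < n)%N by near: n; exact: nbhs_infty_gt.
have [_ /andP[opt_ge _]] := opt_between n0.
have h0 : 0 <= (Num.sqrt n%:R)^-1 :> R by rewrite invr_ge0 sqrtr_ge0.
have opt_half : W / 2 <= opt n.
  by near: n; apply: (cvgr_ge _ opt_cvg); rewrite ltr_pdivrMr// ltr_pMr// ltr1n.
have SCv_le :
    fine (Eiid mu n (SCv (map F qs))) <= fine (qcost mu qs) + C1 / Num.sqrt n%:R.
  apply: (andP (fine_between (r := 0) _).2).2.
  by rewrite (Eiid_SCv_ge0 reg)/=; near: n.
exact: ratio_le_rate D0 W_gt0 C10 C00 h0 opt_half opt_ge SCv_le.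
Unshelve. all: by end_near. Qed.

Lemma Bar_dist_le ps qs (B : R) : size ps = k -> size qs = k ->
  {subset ps <= `[a, b]} -> {subset qs <= `[a, b]} -> 0 <= B ->
  fine (qcost mu ps) <= W + B -> fine (qcost mu qs) <= W + B ->
  exists C, 0 < C /\ forall n, (0 < n)%N ->
    `|Bar mu k n (map F ps) - Bar mu k n (map F qs)| <= B / W + C / Num.sqrt n%:R.
Proof.
move=> psk qsk ps_ab qs_ab B0 ps_cost qs_cost.
have [C C0 C_le] := Bar_le_rate ps_ab; have [C' C'0 C'_le] := Bar_le_rate qs_ab.
have rel_cost D : D <= W + B -> D / W <= 1 + B / W.
  by rewrite ler_pdivrMr// mulrDl mul1r divfK ?gt_eqF.
have /rel_cost ps_rel := ps_cost; have /rel_cost qs_rel := qs_cost.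
have BW_ge0 : 0 <= B / W by rewrite divr_ge0 ?(ltW W_gt0).
apply: (@near_rate_all _ _ (B / W) (C + C')); rewrite ?addr_ge0//; near=> n.
have p1 : 1 <= Bar mu k n (map F ps) by near: n; exact: Bar_ge1.
have q1 : 1 <= Bar mu k n (map F qs) by near: n; exact: Bar_ge1.
have p_le : Bar mu k n (map F ps) <= fine (qcost mu ps) / W + C / Num.sqrt n%:R.
  by near: n.
have q_le : Bar mu k n (map F qs) <= fine (qcost mu qs) / W + C' / Num.sqrt n%:R.
  by near: n.
have [? ?] : 0 <= C / Num.sqrt n%:R /\ 0 <= C' / Num.sqrt n%:R.
  by rewrite !divr_ge0 ?sqrtr_ge0.
by rewrite mulrDl ler_distl; apply/andP; split; lra.
Unshelve. all: by end_near. Qed.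

End ApproximationRatio.

Theorem theorem9 (R : realType) (c d : R) (mu mut nu nut : probability R R)
  (k : nat) (y yt : 'I_k -> R) :
  c <= d ->
  mu (~` [set` `[c, d]]) = 0%E -> mut (~` [set` `[c, d]]) = 0%E ->
  standing mu ->
  (0 < k)%N ->
  W1_opt k mu nu -> sorted_support nu y ->
  W1_opt k mut nut -> sorted_support nut yt ->
  let v_mu := [seq cdfmu mu (y j) | j <- enum 'I_k] in
  let v_mut := [seq cdfmu mut (yt j) | j <- enum 'I_k] in
  let Wi := fine (Winf mu mut) in
  let W1m := fine (W1 mu mut) in
  let W1nu := fine (W1 mu nu) in
  [/\ cvgn (fun n => `|Bar mu k n v_mut - 1|),
      limn (fun n => `|Bar mu k n v_mut - 1|) <= (Wi + 2 * W1m) / W1nu,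
      (Wi + 2 * W1m) / W1nu <= 3 * (Wi / W1nu) &
      exists C : R, 0 < C /\ forall n : nat, (k < n)%N ->
        `|Bar mu k n v_mu - Bar mu k n v_mut|
          <= 3 * (Wi / W1nu) + C / Num.sqrt (n%:R)].
Proof.
move=> _ mu_cd mut_cd mu_st k0 nu_opt [_ [w [_ nuE]]] nut_opt [_ [wt [_ nutE]]].
move=> v_mu v_mut Wi W1m W1nu; have [a [b reg]] := standing_regular mu_st.
have [W1E y_opt] := W1_opt_qcost k0 nu_opt nuE.
have [_ yt_opt] := W1_opt_qcost k0 nut_opt nutE.
have [qs [qsk qs_ab qsF qs_cost]] :=
  exists_quantile_points reg mu_cd mu_cd y_opt.1 y_opt.
have [qts [qtsk qts_ab qtsF qts_cost]] :=
  exists_quantile_points reg mu_cd mut_cd y_opt.1 yt_opt.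
rewrite Winf_refl W1_refl mulr0 !addr0 in qs_cost.
have W_gt0 : 0 < fine (qcost mu (codom y)).
  rewrite fine_gt0// qcost_gt0 ?ltey_eq ?(qcost_fin_num _ mu_cd)//.
  exact: regular_set1 reg.
have -> : v_mu = map (cdfmu mu) qs by rewrite -qsF codomE -map_comp.
have -> : v_mut = map (cdfmu mu) qts by rewrite -qtsF codomE -map_comp.
rewrite /W1nu W1E; set W := fine (qcost mu (codom y)) in W_gt0 qs_cost qts_cost *.
have /andP[W1m_ge0 W1m_le] : 0 <= W1m <= Wi := fine_W1_itv mu_cd mut_cd.
have bound_ge0 : 0 <= Wi + 2 * W1m by lra.
have bound_le : (Wi + 2 * W1m) / W <= 3 * (Wi / W).
  by rewrite mulrA ler_pM2r ?invr_gt0//; lra.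
have [Bar_cv Bar_lim] := Bar_dist1_lim reg y_opt W_gt0 qtsk qts_ab qts_cost.
have {}qs_cost := le_trans qs_cost (ler_wpDr bound_ge0 (lexx W)).
have [C [C0 C_le]] :=
  Bar_dist_le reg y_opt W_gt0 qsk qtsk qs_ab qts_ab bound_ge0 qs_cost qts_cost.
split => //; exists C; split=> // n kn.
by apply: le_trans (C_le n (leq_ltn_trans _ kn)) _; rewrite ?lerD2r.
Qed.
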